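(* Let $k\ge2$ be an integer and let $\varepsilon>0$. There exists $d_0\in\mathbb{N}$ such that the following holds for every $d\ge d_0$. Let $\mathcal{H}$ be a $k$-uniform uncrowded hypergraph, and let $\mathcal{L}:V(\mathcal{H})\to2^{\mathbb{N}}$ be a list assignment such that: (C1) for every $v\in V(\mathcal{H})$, $|\mathcal{L}(v)|\ge(1+\varepsilon)\left((k-1)\,\frac{d}{\log d}\right)^{\frac{1}{k-1}}$; and (C2) for every $v\in V(\mathcal{H})$ and $c\in\mathcal{L}(v)$, the number of edges $e\in E(\mathcal{H})$ with $v\in e$ and $c\in\bigcap_{u\in e}\mathcal{L}(u)$ is at most $d$. Then $\mathcal{H}$ admits an $\mathcal{L}$-coloring.
   Context: A hypergraph is a pair $(V,E)$ with $V$ a finite set and $E\subseteq 2^V$; it is $k$-uniform if every edge has exactly $k$ elements. For $r\ge2$, an $r$-cycle consists of $r$ distinct edges $e_0,\dots,e_{r-1}$ for which there are distinct vertices $v_1,\dots,v_r$ with $v_i\in e_i\cap e_{i+1}$ for $1\le i\le r$ (indices modulo $r$). A hypergraph is uncrowded if it contains no $r$-cycle for $2\le r\le4$. An $\mathcal{L}$-coloring of $\mathcal{H}$ is a function $\Phi:V(\mathcal{H})\to\mathbb{N}$ with $\Phi(v)\in\mathcal{L}(v)$ for every $v$ such that no edge is monochromatic. $\log$ is the natural logarithm. *)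

(* Defs.v *)
From HB Require Import structures.
From mathcomp Require Import all_boot all_order all_algebra.
From mathcomp Require Import all_classical all_reals all_analysis.

Set Implicit Arguments.
Unset Strict Implicit.
Unset Printing Implicit Defensive.

Import Order.TTheory GRing.Theory Num.Theory.

Local Open Scope classical_set_scope.

(* A hypergraph with vertex set V is given by its edge set E : {set {set V}}. *)
Section Hypergraph.
Variable V : finType.
Implicit Types (E : {set {set V}}) (L : V -> set nat).

Definition uniform E (k : nat) : Prop := forall e, e \in E -> #|e| = k.

(* Indices are residues modulo r, so that v_r is v at index 0; it lies in
   e_0 and e_1. *)
Definition has_cycle E (r : nat) : Prop :=
  exists (e : 'I_r -> {set V}) (v : 'I_r -> V),
    [/\ injective e, forall i, e i \in E, injective v &
        forall i, (v i \in e i) && (v i \in e (ordS i))].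

Definition uncrowded E : Prop :=
  forall r : nat, (2 <= r <= 4)%N -> ~ has_cycle E r.

Definition color_degree E L (v : V) (c : nat) : nat :=
  #|[pred e in E | (v \in e) && (c \in \bigcap_(u in [set` e]) L u)]|.

Definition monochromatic (Phi : V -> nat) (e : {set V}) : Prop :=
  exists c : nat, forall u, u \in e -> Phi u = c.

Definition list_coloring E L (Phi : V -> nat) : Prop :=
  (forall v, L v (Phi v)) /\ (forall e, e \in E -> ~ monochromatic Phi e).

End Hypergraph.

(* Main.v *)
(* A semi-random colouring. Put m = k - 1. In each round every uncoloured vertex u
   picks each colour c of its list independently with probability al / N, where
   N is the current list size. Colour c is deleted at u if, in some edge through u
   that can still become monochromatic in c, all other uncoloured vertices pick c;
   a further random deletion makes every colour survive with the same probability.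
   A vertex takes one of its picked surviving colours. Picks of different colours
   are independent, hence so are the survivals of different colours at u.

   One keeps track of the number of edges at v whose other vertices are all
   coloured c, except for i uncoloured ones with c in their lists; it stays below
   D C(m, i) (b N)^i x^(m - i), the i-th term of D (b N + x)^m, where b is the
   fraction of uncoloured vertices and D = d / N0^m for the initial list size N0.
   Here x + b stays close to 1 and N decreases like N0 exp(- D x^m). Since
   D = ln d / (m (1 + eps)^m) and N0 is about d^(1/m), the lists keep a size
   d^c with c > 0 until b <= (ln d)^(-2); then a uniformly random choice from the
   lists finishes by the local lemma.

   Since the hypergraph is uncrowded, the fates of the neighbours of v are
   independent once the picks of v are fixed, so Chernoff bounds control one
   round at a single vertex, and the local lemma controls all of them. *)
Require Import Defs.
From HB Require Import structures.
From mathcomp Require Import all_boot all_order all_algebra.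
From mathcomp Require Import all_classical all_reals all_analysis.
(* Their names must win over those of classical_sets. *)
From mathcomp Require Import fintype finset.
From mathcomp Require Import ring lra zify.
Set Implicit Arguments.
Unset Strict Implicit.
Unset Printing Implicit Defensive.
Import Order.TTheory GRing.Theory Num.Theory.
Local Open Scope ring_scope.

(** * Finite product spaces: Chernoff bounds and the local lemma *)

(** The binomial form is preserved because a round is a binomial thinning: if each of [j] uncoloured
    vertices stays uncoloured with weight [u] and takes [c] with weight [v], then [(b N, x)] becomes
    [(b N u, x + b N v)]. At pick probability [al / N], the union bound for deleting a colour is
    [D ((x + al b)^m - x^m)], nearly the increment of [D x^m] during the round; the product of the
    survival probabilities thus telescopes to about [exp(- D x^m)]. At [x = 1] the lists have size
    about [d] to the power [(1 - (1 + eps)^(-m)) / m], positive exactly because of the constant in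
    (C1). The obstacle to independence is the edge [e] joining [v] to a neighbour [u]: through it
    the picks of [v] can delete colours at [u]. Forbidding [e] to delete anything costs a factor at
    most [1 / (1 - al / N)], but [u] may then seem to take a colour that [e] deletes in truth. Such
    a colour is picked by [v], hence the conditioning on the set picked by [v] and the exclusion of
    that set. *)

Lemma expRN_le (R : realType) (t : R) : 0 <= t -> expR (- t) <= 1 - t + t ^+ 2.
Proof.
move=> t0; have h : 1 + t <= expR t by exact: expR_ge1Dx.
have e0 := expR_gt0 (- t).
have e1 : expR t * expR (- t) = 1 by rewrite expRxMexpNx_1.
have e2 : (1 + t) * expR (- t) <= 1 by rewrite -[leRHS]e1 ler_pM2r.
(* The product equals [1 + t ^+ 3]. *)
have e3 : 1 <= (1 + t) * (1 - t + t ^+ 2).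
  have : 0 <= t ^+ 3 by rewrite exprn_ge0.
  lra.
have := le_trans e2 e3; rewrite ler_pM2l //; lra.
Qed.

Section ProductSpace.
Variables (R : realType) (I A : finType) (mu : I -> A -> R).
Hypothesis mu_ge0 : forall i a, 0 <= mu i a.
Hypothesis mu_sum1 : forall i, \sum_a mu i a = 1.

Local Notation Omega := {ffun I -> A}.

Definition weight (w : Omega) : R := \prod_i mu i (w i).
Definition Exp (f : Omega -> R) : R := \sum_w weight w * f w.
Definition Prb (B : Omega -> bool) : R := Exp (fun w => (B w)%:R).

(** Independence is always derived from disjoint sets of coordinates, so each event below comes with
    a set on which it depends. *)
Definition depends_on T (S : pred I) (f : Omega -> T) :=
  forall w w' : Omega, (forall i, S i -> w i = w' i) -> f w = f w'.

Lemma weight_ge0 w : 0 <= weight w.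
Proof. by apply: prodr_ge0 => i _. Qed.

Lemma Exp_prod_coord (f : I -> A -> R) :
  Exp (fun w => \prod_i f i (w i)) = \prod_i \sum_a mu i a * f i a.
Proof.
rewrite (bigA_distr_bigA (fun i a => mu i a * f i a)).
by apply: eq_bigr => w _; rewrite big_split.
Qed.

Lemma eq_Exp f g : f =1 g -> Exp f = Exp g.
Proof. by move=> fg; apply: eq_bigr => w _; rewrite fg. Qed.

Lemma weight_sum1 : \sum_w weight w = 1.
Proof.
have <- : \prod_(i : I) \sum_a mu i a = 1 by rewrite big1.
by rewrite (bigA_distr_bigA mu).
Qed.

Lemma Exp_cst c : Exp (fun=> c) = c.
Proof. by rewrite /Exp -mulr_suml weight_sum1 mul1r. Qed.

Lemma Exp_coord i (f : A -> R) : Exp (fun w => f (w i)) = \sum_a mu i a * f a.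
Proof.
pose F j a := if j == i then f a else 1.
have -> : Exp (fun w => f (w i)) = Exp (fun w => \prod_j F j (w j)).
  apply: eq_Exp => w; rewrite (bigD1 i) //= /F eqxx big1 ?mulr1 // => j.
  by move=> /negPf ->.
rewrite Exp_prod_coord (bigD1 i) //= [X in _ * X]big1 => [|j /negPf ji].
  by rewrite mulr1; apply: eq_bigr => a _; rewrite /F eqxx.
by rewrite -[RHS](mu_sum1 j); apply: eq_bigr => a _; rewrite /F ji mulr1.
Qed.

Lemma le_Exp f g : (forall w, f w <= g w) -> Exp f <= Exp g.
Proof. by move=> fg; apply: ler_sum => w _; rewrite ler_wpM2l ?weight_ge0. Qed.

Lemma ExpD f g : Exp (fun w => f w + g w) = Exp f + Exp g.
Proof. by rewrite -big_split /=; apply: eq_bigr => w _; rewrite mulrDr. Qed.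

Lemma ExpZ c f : Exp (fun w => c * f w) = c * Exp f.
Proof. by rewrite big_distrr; apply: eq_bigr => w _; rewrite mulrCA. Qed.

Lemma Exp_sum (J : Type) (s : seq J) (P : pred J) (f : J -> Omega -> R) :
  Exp (fun w => \sum_(j <- s | P j) f j w) = \sum_(j <- s | P j) Exp (f j).
Proof. by rewrite exchange_big; apply: eq_bigr => w _; rewrite mulr_sumr. Qed.

Lemma Exp_ge0 f : (forall w, 0 <= f w) -> 0 <= Exp f.
Proof. by move=> f0; apply: sumr_ge0 => w _; rewrite mulr_ge0 ?weight_ge0. Qed.

Lemma Prb_ge0 B : 0 <= Prb B.
Proof. exact: Exp_ge0. Qed.

Lemma eq_Prb B B' : B =1 B' -> Prb B = Prb B'.
Proof. by move=> BB; apply: eq_Exp => w; rewrite BB. Qed.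

Lemma le_Prb (B B' : Omega -> bool) : (forall w, B w -> B' w) -> Prb B <= Prb B'.
Proof.
move=> BB; apply: le_Exp => w; rewrite ler_nat.
by case: (B w) (BB w) => // ->.
Qed.

Lemma Prb_le1 B : Prb B <= 1.
Proof. by rewrite -[leRHS](Exp_cst 1); apply: le_Exp => w; rewrite lern1 leq_b1. Qed.

Lemma PrbC B : Prb (fun w => ~~ B w) = 1 - Prb B.
Proof.
apply/eqP; rewrite eq_sym subr_eq -ExpD -[eqbLHS](Exp_cst 1); apply/eqP/eq_Exp => w.
by case: (B w); rewrite /= ?addr0 ?add0r.
Qed.

Lemma PrbU (B B' : Omega -> bool) : Prb (fun w => B w || B' w) <= Prb B + Prb B'.
Proof.
rewrite -ExpD; apply: le_Exp => w; rewrite -natrD ler_nat.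
by case: (B w); case: (B' w).
Qed.

Lemma Prb_exists (J : finType) (P : pred J) (B : J -> Omega -> bool) :
  Prb (fun w => [exists j, P j && B j w]) <= \sum_(j | P j) Prb (B j).
Proof.
rewrite -Exp_sum; apply: le_Exp => w.
case: existsP => [[j /andP[Pj Bj]]|_]; last exact: sumr_ge0.
by rewrite (bigD1 j) //= Bj lerDl sumr_ge0.
Qed.

Lemma markov_exp (X : Omega -> R) a :
  Prb (fun w => a <= X w) <= Exp (fun w => expR (X w - a)).
Proof.
apply: le_Exp => w; case: (lerP a (X w)) => [aX|_]; last exact: expR_ge0.
by rewrite -expR0 ler_expR subr_ge0.
Qed.

(** * Independence from disjoint sets of coordinates *)

Section Independence.

Definition splice (S : pred I) (w w' : Omega) : Omega :=
  [ffun i => if S i then w i else w' i].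

(* Exchanging, between two independent copies, the coordinates outside S is a
   weight-preserving involution which turns [f w * g w'] into [f w * g w]. *)
Lemma ExpM (S S' : pred I) (f g : Omega -> R) :
  depends_on S f -> depends_on S' g -> (forall i, S i -> ~~ S' i) ->
  Exp (fun w => f w * g w) = Exp f * Exp g.
Proof.
move=> df dg dis; rewrite /Exp big_distrl /=.
under [RHS]eq_bigr do rewrite big_distrr.
rewrite pair_bigA /=.
pose h (p : Omega * Omega) := (splice S p.1 p.2, splice S p.2 p.1).
have hK : involutive h.
  by case=> w w'; congr pair; apply/ffunP => i; rewrite !ffunE; case: (S i).
rewrite (reindex_inj (inv_inj hK)) /=.
transitivity (\sum_w \sum_w' (weight w * weight w') * (f w * g w)).
  apply: eq_bigr => w _; rewrite -mulr_suml -mulr_sumr weight_sum1 mulr1 //.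
rewrite pair_bigA /=; apply: eq_bigr => -[w w'] _ /=.
have -> : f (splice S w w') = f w.
  by apply: df => i Si; rewrite ffunE Si.
have -> : g (splice S w' w) = g w.
  apply: dg => i S'i; rewrite ffunE; case: ifP => // Si.
  by have := dis _ Si; rewrite S'i.
have -> : weight w * weight w' = weight (splice S w w') * weight (splice S w' w).
  rewrite /weight -!big_split; apply: eq_bigr => i _; rewrite /= !ffunE.
  by case: (S i) => //; rewrite mulrC.
by rewrite mulrACA.
Qed.

Lemma depends_on_comp T U (S : pred I) (f : Omega -> T) (g : T -> U) :
  depends_on S f -> depends_on S (fun w => g (f w)).
Proof. by move=> df w w' ww; rewrite (df _ _ ww). Qed.

Lemma Exp_bigprod (J : finType) (P : pred J) (S : J -> pred I)
    (f : J -> Omega -> R) :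
  (forall j, P j -> depends_on (S j) (f j)) ->
  (forall j j' i, P j -> P j' -> S j i -> S j' i -> j = j') ->
  Exp (fun w => \prod_(j | P j) f j w) = \prod_(j | P j) Exp (f j).
Proof.
move=> df dis; rewrite -big_filter.
under eq_Exp do rewrite -big_filter.
have : all P [seq j <- index_enum J | P j] by apply: filter_all.
have : uniq [seq j <- index_enum J | P j].
  by rewrite filter_uniq // index_enum_uniq.
elim: [seq _ <- _ | _] => [|j s IH] /=.
  by move=> _ _; rewrite big_nil; under eq_Exp do rewrite big_nil; rewrite Exp_cst.
move=> /andP[js us] /andP[Pj Ps].
rewrite big_cons; under eq_Exp do rewrite big_cons.
rewrite -(IH us Ps).
apply: (@ExpM (S j) (fun i => has (fun j' => S j' i) s)).
- exact: df.
- move=> w w' ww; apply: eq_big_seq => j' j's.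
  apply: df => [|i Si]; first exact: (allP Ps).
  by apply: ww; apply/hasP; exists j'.
- move=> i Sji; apply/hasPn => j' j's; apply/negP => Sj'i.
  by move: js; rewrite (dis _ _ _ Pj (allP Ps _ j's) Sji Sj'i) j's.
Qed.

Lemma prod_boolR (J : finType) (P : pred J) (b : J -> bool) :
  \prod_(j | P j) (b j)%:R = ([forall j, P j ==> b j])%:R :> R.
Proof.
case: forallP => [b1|/forallP]; first by rewrite big1 // => j Pj; have := b1 j; rewrite Pj /= => ->.
rewrite negb_forall => /existsP[j]; rewrite negb_imply => /andP[Pj /negPf bj].
by rewrite (bigD1 j) //= bj mul0r.
Qed.

Lemma Prb_forall (J : finType) (P : pred J) (S : J -> pred I)
    (B : J -> Omega -> bool) :
  (forall j, P j -> depends_on (S j) (B j)) ->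
  (forall j j' i, P j -> P j' -> S j i -> S j' i -> j = j') ->
  Prb (fun w => [forall j, P j ==> B j w]) = \prod_(j | P j) Prb (B j).
Proof.
move=> dB dis; rewrite /Prb; under eq_Exp do rewrite -prod_boolR.
apply: (Exp_bigprod (S := S)) => // j Pj.
exact: (depends_on_comp (fun b : bool => b%:R) (dB j Pj)).
Qed.

Lemma Prb_and (S S' : pred I) (B B' : Omega -> bool) :
  depends_on S B -> depends_on S' B' -> (forall i, S i -> ~~ S' i) ->
  Prb (fun w => B w && B' w) = Prb B * Prb B'.
Proof.
move=> dB dB' dis.
rewrite -(@ExpM S S' (fun w => (B w)%:R) (fun w => (B' w)%:R)) //.
- by apply: eq_Exp => w; rewrite -mulnb natrM.
- exact: (depends_on_comp (fun b : bool => b%:R) dB).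
- exact: (depends_on_comp (fun b : bool => b%:R) dB').
Qed.

End Independence.

(** * Chernoff bounds for sums of independent indicators *)

Section Chernoff.
Variables (J : finType) (P : pred J) (S : J -> pred I) (B : J -> Omega -> bool).
Hypothesis dB : forall j, P j -> depends_on (S j) (B j).
Hypothesis dis : forall j j' i, P j -> P j' -> S j i -> S j' i -> j = j'.

Let X w : nat := #|[pred j | P j && B j w]|.

Lemma exp_moment_le (t : R) :
  Exp (fun w => expR (t * (X w)%:R)) <= expR ((expR t - 1) * \sum_(j | P j) Prb (B j)).
Proof.
have XE w : expR (t * (X w)%:R) = \prod_(j | P j) (1 + (expR t - 1) * (B j w)%:R).
  rewrite /X -sum1_card natr_sum mulr_sumr expR_sum.
  rewrite [RHS](bigID (fun j => B j w)) /= [X in _ = _ * X]big1 ?mulr1; last first.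
    by move=> j /andP[_ /negPf ->]; rewrite mulr0 addr0.
  by apply: eq_big => // j /andP[_ ->]; rewrite !mulr1 addrC subrK.
under eq_Exp do rewrite XE.
rewrite (Exp_bigprod (S := S)) //; last first.
  move=> j Pj.
  exact: (depends_on_comp (fun b : bool => 1 + (expR t - 1) * b%:R) (dB Pj)).
rewrite mulr_sumr expR_sum; apply: ler_prod => j Pj.
rewrite ExpD Exp_cst ExpZ expR_ge1Dx andbT -/(Prb (B j)).
have p0 := Prb_ge0 (B j); have p1 := Prb_le1 (B j); have := expR_ge0 t.
nra.
Qed.

(** The exponent is at most [(t + 2 * t ^+ 2) * m - t * a]; the threshold factor [1 + 3 * t] is
    chosen to leave [- t ^+ 2 * m]. *)
Lemma chernoff_upper (t m a : R) : 0 <= t <= 2^-1 ->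
  \sum_(j | P j) Prb (B j) <= m -> (1 + 3 * t) * m <= a ->
  Prb (fun w => a <= (X w)%:R) <= expR (- (t ^+ 2 * m)).
Proof.
move=> /andP[t0 t1] Sm am.
have m0 : 0 <= m by apply: le_trans Sm; apply: sumr_ge0 => j _; apply: Prb_ge0.
(* For [t <= 2^-1] one has [(1 + t + 2 * t ^+ 2) * (1 - t) >= 1]. *)
have et : expR t <= 1 + t + 2 * t ^+ 2.
  have h : 1 - t <= expR (- t) by exact: expR_ge1Dx.
  have e0 := expR_gt0 t.
  have e1 : expR t * expR (- t) = 1 by rewrite expRxMexpNx_1.
  have e2 : expR t * (1 - t) <= 1 by rewrite -[leRHS]e1 ler_pM2l.
  nra.
apply: (@le_trans _ _ (Prb (fun w => t * a <= t * (X w)%:R))).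
  by apply: le_Prb => w h; rewrite ler_wpM2l.
apply: le_trans (markov_exp _ _) _.
under eq_Exp do rewrite expRD mulrC.
rewrite ExpZ; apply: (@le_trans _ _ (expR (- (t * a)) * expR ((t + 2 * t ^+ 2) * m))).
  rewrite ler_wpM2l ?expR_ge0 //; apply: le_trans (exp_moment_le _) _.
  rewrite ler_expR.
  have e1 : 1 <= expR t by rewrite -[leLHS]expR0 ler_expR.
  apply: (@le_trans _ _ ((expR t - 1) * m)); first by rewrite ler_wpM2l ?subr_ge0.
  by rewrite ler_wpM2r //; lra.
rewrite -expRD ler_expR.
have : t * ((1 + 3 * t) * m) <= t * a by rewrite ler_wpM2l.
lra.
Qed.

Lemma chernoff_lower (t m a : R) : 0 <= t ->
  m <= \sum_(j | P j) Prb (B j) -> a <= (1 - 2 * t) * m -> 0 <= m ->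
  Prb (fun w => (X w)%:R <= a) <= expR (- (t ^+ 2 * m)).
Proof.
move=> t0 Sm am m0.
have et := expRN_le t0.
apply: (@le_trans _ _ (Prb (fun w => - (t * a) <= - t * (X w)%:R))).
  by apply: le_Prb => w h; rewrite mulNr lerN2 ler_wpM2l.
apply: le_trans (markov_exp _ _) _.
under eq_Exp do rewrite opprK expRD mulrC.
rewrite ExpZ; apply: (@le_trans _ _ (expR (t * a) * expR (- (t - t ^+ 2) * m))).
  rewrite ler_wpM2l ?expR_ge0 //; apply: le_trans (exp_moment_le _) _.
  rewrite ler_expR.
  have e1 : expR (- t) <= 1 by rewrite -[leRHS]expR0 ler_expR; lra.
  rewrite -lerN2 -!mulNr opprB opprK.
  apply: (@le_trans _ _ ((1 - expR (- t)) * m)); last by rewrite ler_wpM2l ?subr_ge0.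
  by rewrite ler_wpM2r //; lra.
rewrite -expRD ler_expR.
have : t * a <= t * ((1 - 2 * t) * m) by rewrite ler_wpM2l.
lra.
Qed.

End Chernoff.

(** * The Lovasz local lemma *)

Section LocalLemma.
Variables (J : finType) (S : J -> pred I) (B : J -> Omega -> bool).
Hypothesis dB : forall j, depends_on (S j) (B j).
Hypothesis B_le : forall j, Prb (B j) <= 4^-1.
Hypothesis nbr_le : forall j,
  \sum_(j' | [exists i, S j i && S j' i]) Prb (B j') <= 4^-1.

Let G (Q : {set J}) (w : Omega) := [forall j, (j \in Q) ==> ~~ B j w].

Let dG (Q : {set J}) : depends_on (fun i => [exists j, (j \in Q) && S j i]) (G Q).
Proof.
move=> w w' ww; apply: eq_forallb => j; case: (boolP (j \in Q)) => // jQ /=.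
by congr negb; apply: dB => i Si; apply: ww; apply/existsP; exists j; rewrite jQ.
Qed.

(** Split [Q] into the events sharing a coordinate with [j] and the rest [M]. [B j] is independent
    of [G M], and by induction the sharing events fill at most half of [G M], so
    [Prb (G M) <= 2 * Prb (G Q)]. The product form avoids conditioning on an event not yet known to
    have positive probability. *)
Lemma local_lemma_ind (n : nat) (Q : {set J}) (j : J) : (#|Q| <= n)%N ->
  Prb (fun w => B j w && G Q w) <= 2 * Prb (B j) * Prb (G Q).
Proof.
elim: n Q j => [|n IH] Q j Qn.
  have Q0 : forall w, G Q w.
    move=> w; apply/forallP => i; move: Qn; rewrite leqn0 cards_eq0 => /eqP ->.
    by rewrite inE.
  have -> : Prb (G Q) = 1 by rewrite -[RHS](Exp_cst 1); apply: eq_Exp => w; rewrite Q0.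
  have -> : Prb (fun w => B j w && G Q w) = Prb (B j).
    by apply: eq_Prb => w; rewrite Q0 andbT.
  by have := Prb_ge0 (B j); lra.
pose N := [set j' in Q | [exists i, S j i && S j' i]].
pose M := Q :\: N.
have BM : Prb (fun w => B j w && G M w) = Prb (B j) * Prb (G M).
  apply: (Prb_and (@dB j) (@dG M)) => i Sji; apply/existsPn => j'.
  rewrite negb_and; case: (boolP (S j' i)); rewrite ?orbT // => Sj'i.
  rewrite orbF !inE negb_and negbK; case: (boolP (j' \in Q)) => //= _.
  by rewrite orbF; apply/existsP; exists i; rewrite Sji.
have le1 : Prb (fun w => B j w && G Q w) <= Prb (B j) * Prb (G M).
  rewrite -BM; apply: le_Prb => w /andP[-> /forallP g]; apply/forallP => j'.
  by apply/implyP; rewrite !inE => /andP[_ j'Q]; have := g j'; rewrite j'Q.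
(* If nothing is shared then [M = Q] and the induction hypothesis is out of reach, but independence
   alone suffices. *)
have [N0|[j0 j0N]] := set_0Vmem N.
  have -> : Q = M by rewrite /M N0 finset.setD0.
  rewrite BM; have := Prb_ge0 (B j); have := Prb_ge0 (G M); nra.
have Mn : (#|M| <= n)%N.
  rewrite -ltnS; apply: leq_trans Qn; apply: proper_card; apply/properP; split.
    exact: finset.subsetDl.
  by exists j0; [move: j0N; rewrite inE => /andP[] | rewrite inE j0N].
have : Prb (G M) <= Prb (G Q) + \sum_(j' in N) Prb (fun w => B j' w && G M w).
  apply: le_trans (_ : _ <= Prb (fun w => G Q w ||
      [exists j', (j' \in N) && (B j' w && G M w)])) _.
    apply: le_Prb => w gM; case: (boolP (G Q w)) => //=.
    rewrite negb_forall => /existsP[j']; rewrite negb_imply negbK => /andP[j'Q Bj'].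
    apply/existsP; exists j'; rewrite Bj' gM !andbT.
    apply: contraLR gM => j'N; rewrite negb_forall; apply/existsP; exists j'.
    by rewrite inE j'N j'Q /= negbK.
  apply: le_trans (PrbU _ _) _; rewrite lerD2l; exact: Prb_exists.
have : \sum_(j' in N) Prb (fun w => B j' w && G M w) <= 2^-1 * Prb (G M).
  apply: (@le_trans _ _ (\sum_(j' in N) 2 * Prb (G M) * Prb (B j'))).
    by apply: ler_sum => j' _; rewrite mulrAC; apply: IH.
  rewrite -mulr_sumr.
  have : \sum_(j' in N) Prb (B j') <= 4^-1.
    apply: le_trans (nbr_le j); rewrite [leRHS](bigID (mem Q)) /=.
    rewrite -[leLHS]addr0 lerD //; last by apply: sumr_ge0 => *; apply: Prb_ge0.
    by rewrite le_eqVlt; apply/orP; left; apply/eqP; apply: eq_bigl => j'; rewrite inE andbC.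
  have := Prb_ge0 (G M); set s := \sum_(j' in N) _; nra.
have := Prb_ge0 (B j); have := Prb_ge0 (G M); nra.
Qed.

(** The positive weight of [w] is needed by the last round, which reads membership in the lists off
    the support of the measure. *)
Theorem local_lemma : exists2 w, 0 < weight w & forall j, ~~ B j w.
Proof.
have pos (Q : {set J}) : 0 < Prb (G Q).
  elim/ssrnat.ltn_ind: {Q}#|Q| {-2}Q (erefl #|Q|) => n IH Q Qn.
  have [->|[j jQ]] := set_0Vmem Q.
    rewrite (_ : Prb _ = 1) ?ltr01 // -[RHS](Exp_cst 1); apply: eq_Exp => w.
    by rewrite (_ : G _ w) //; apply/forallP => j; rewrite inE.
  have Q'n : (#|Q :\ j| < n)%N by rewrite -Qn [X in (_ < X)%N](cardsD1 j) jQ.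
  have p := IH _ Q'n _ (erefl _).
  have : Prb (G (Q :\ j)) <= Prb (G Q) + Prb (fun w => B j w && G (Q :\ j) w).
    apply: le_trans (PrbU _ _); apply: le_Prb => w gM.
    rewrite gM andbT; case: (boolP (B j w)); rewrite ?orbT // orbF => nB.
    apply/forallP => i; apply/implyP => iQ; case: (eqVneq i j) => [->//|ij].
    by have := forallP gM i; rewrite !inE ij iQ.
  have := local_lemma_ind j (leqnn #|Q :\ j|); have := B_le j.
  have := Prb_ge0 (B j); nra.
have := pos [set: J]%SET.
case: (pickP (fun w => (0 < weight w) && [forall j, ~~ B j w])).
  by move=> w /andP[w0 /forallP h] _; exists w.
move=> h; rewrite /Prb /Exp big1 ?ltxx // => w _; have := h w.
rewrite lt_def weight_ge0 andbT; case: eqP => [->|_ /= wB]; first by rewrite mul0r.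
rewrite (_ : G _ w = false) ?mulr0 // -wB.
by apply: eq_forallb => j; rewrite inE.
Qed.

End LocalLemma.

End ProductSpace.

(** * Branches in uncrowded hypergraphs *)

Section Uncrowded.
Variables (V : finType) (E : {set {set V}}).
Hypothesis uE : uncrowded E.

Lemma no_cycle r (e : 'I_r -> {set V}) (v : 'I_r -> V) :
  (2 <= r <= 4)%N -> injective e -> (forall i, e i \in E) -> injective v ->
  (forall i, v i \in e i) -> (forall i, v i \in e (ordS i)) -> False.
Proof.
move=> r24 ie eE iv ve ve'; apply: (uE r24); exists e, v; split=> // i.
by rewrite ve ve'.
Qed.

Lemma uncrowded_linear e f u x : e \in E -> f \in E -> e != f ->
  u \in e -> u \in f -> x \in e -> x \in f -> u = x.
Proof.
move=> eE fE ef ue uf xe xf; apply/eqP/negPn/negP => ux.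
apply: (@no_cycle 2 (fun i => tnth [tuple e; f] i) (fun i => tnth [tuple u; x] i)) => //.
- by apply/tuple_uniqP; rewrite /= inE ef.
- by case=> -[|[|i]] // Hi; rewrite (tnth_nth e).
- by apply/tuple_uniqP; rewrite /= inE ux.
- by case=> -[|[|i]] // Hi; rewrite (tnth_nth e) (tnth_nth u).
- by case=> -[|[|i]] // Hi; rewrite (tnth_nth e) (tnth_nth u).
Qed.

Lemma uncrowded_no3 e f g u x y : e \in E -> f \in E -> g \in E ->
  e != f -> e != g -> f != g -> u != x -> u != y -> x != y ->
  u \in e -> u \in f -> x \in f -> x \in g -> y \in g -> y \in e -> False.
Proof.
move=> eE fE gE ef eg fg ux uy xy ue uf xf xg yg ye.
apply: (@no_cycle 3 (fun i => tnth [tuple e; f; g] i)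
  (fun i => tnth [tuple u; x; y] i)) => //.
- by apply/tuple_uniqP; rewrite /= !inE !negb_or ef eg fg.
- by case=> -[|[|[|i]]] // Hi; rewrite (tnth_nth e).
- by apply/tuple_uniqP; rewrite /= !inE !negb_or ux uy xy.
- by case=> -[|[|[|i]]] // Hi; rewrite (tnth_nth e) (tnth_nth u).
- by case=> -[|[|[|i]]] // Hi; rewrite (tnth_nth e) (tnth_nth u).
Qed.

Lemma uncrowded_no4 e f g h u x y z :
  e \in E -> f \in E -> g \in E -> h \in E -> uniq [:: e; f; g; h] ->
  uniq [:: u; x; y; z] ->
  u \in e -> u \in f -> x \in f -> x \in g -> y \in g -> y \in h ->
  z \in h -> z \in e -> False.
Proof.
move=> eE fE gE hE ue uv *.
apply: (@no_cycle 4 (fun i => tnth [tuple e; f; g; h] i)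
  (fun i => tnth [tuple u; x; y; z] i)) => //.
- exact/tuple_uniqP.
- by case=> -[|[|[|[|i]]]] // Hi; rewrite (tnth_nth e).
- exact/tuple_uniqP.
- by case=> -[|[|[|[|i]]]] // Hi; rewrite (tnth_nth e) (tnth_nth u).
- by case=> -[|[|[|[|i]]]] // Hi; rewrite (tnth_nth e) (tnth_nth u).
Qed.

(* The vertices whose picks can affect u through edges other than e. *)
Definition branch (e : {set V}) (u x : V) :=
  (x == u) || [exists f in E, [&& f != e, u \in f & x \in f]].

Lemma branchP e u x :
  reflect (x = u \/ exists f, [/\ f \in E, f != e, u \in f & x \in f]) (branch e u x).
Proof.
apply: (iffP orP) => -[/eqP|]; [by left| |by left|].
- by case/exists_inP => f fE /and3P[? ? ?]; right; exists f.
- by case=> f [fE fe uf xf]; right; apply/exists_inP; exists f; rewrite ?fe ?uf.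
Qed.

(** A consequence of linearity; it frees the fates of the neighbours of [v] from the picks of
    [v]. *)
Lemma branch_root e u v : e \in E -> v \in e -> u \in e -> u != v -> ~~ branch e u v.
Proof.
move=> eE ve ue uv; apply/branchP => -[vu|[f [fE fe uf vf]]].
  by rewrite vu eqxx in uv.
by move/eqP: uv; apply; apply: (uncrowded_linear eE fE) => //; rewrite eq_sym.
Qed.

(** A common vertex [x] closes the walk [v, u, x, u'] to a cycle: of length 4 in general, of length
    3 if [e = e'] or if one further edge contains both [u] and [u'], of length 2 in the remaining
    degenerate cases. As [e = e'] is allowed, vertices of the same edge are covered too. *)
Lemma branch_disjoint v e e' u u' x : e \in E -> e' \in E -> v \in e -> v \in e' ->
  u \in e -> u' \in e' -> u != v -> u' != v ->
  branch e u x -> branch e' u' x -> u = u'.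
Proof.
move=> eE e'E ve ve' ue u'e' uv u'v.
have lin := uncrowded_linear.
have vu : v != u by rewrite eq_sym.
have vu' : v != u' by rewrite eq_sym.
have common f : f \in E -> u \in f -> u' \in f -> f != e -> f != e' -> u != u' -> False.
  move=> fE uf u'f fe fe' uu'; case: (eqVneq e e') => [ee|ee].
    move/eqP: uu'; apply; apply: (lin f e) => //; rewrite ?ee //.
  by apply: (@uncrowded_no3 e e' f v u' u) => //; rewrite 1?eq_sym // eq_sym.
have ue' : e != e' -> u \notin e'.
  by move=> ee; apply/negP => ue'; move/eqP: uv; apply; apply: (lin e e').
have u'e : e != e' -> u' \notin e.
  by move=> ee; apply/negP => u'e; move/eqP: u'v; apply; apply: (lin e e').
have share f : f \in E -> f != e -> u \in f -> u' \in f -> u != u' -> False.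
  move=> fE fe uf u'f uu'; case: (eqVneq f e') => [fe'|fe']; last exact: (@common f).
  have ee : e != e' by rewrite -fe' eq_sym.
  by move: (ue' ee); rewrite -fe' uf.
have share' f : f \in E -> f != e' -> u \in f -> u' \in f -> u != u' -> False.
  move=> fE fe uf u'f uu'; case: (eqVneq f e) => [fe'|fe']; last exact: (@common f).
  have ee : e != e' by rewrite -fe'.
  by move: (u'e ee); rewrite -fe' u'f.
move=> /branchP h /branchP h'; apply/eqP/negPn/negP => uu'.
case: h h' => [->|[f [fE fe uf xf]]].
  by case=> [uu|[f [fE fe uf xf]]]; [rewrite uu eqxx in uu' | apply: (share' f)].
case=> [xu'|[f' [f'E fe' u'f' xf']]]; first by apply: (share f) => //; rewrite -xu'.
case: (eqVneq f f') => [ff|ff]; first by apply: (share f) => //; rewrite ff.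
case: (eqVneq x u) => [xu|xu]; first by apply: (share' f') => //; rewrite -xu.
case: (eqVneq x u') => [xu2|xu2]; first by apply: (share f) => //; rewrite -xu2.
case: (eqVneq e e') => [ee|ee].
  apply: (@uncrowded_no3 e f f' u x u') => //; rewrite 1?eq_sym // ?ee //.
have xv : x != v.
  apply/eqP => xv; move/eqP: uv; apply; apply: (lin f e) => //; rewrite -xv //.
have fe2 : f != e' by apply/eqP => h; move: (ue' ee); rewrite -h uf.
have fe3 : f' != e by apply/eqP => h; move: (u'e ee); rewrite -h u'f'.
apply: (@uncrowded_no4 e e' f' f v u' x u) => //.
- rewrite /= !inE !negb_or ee (eq_sym e f') fe3 (eq_sym e f) fe (eq_sym e' f') fe'.
  by rewrite (eq_sym e' f) fe2 (eq_sym f' f) ff.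
- by rewrite /= !inE !negb_or vu' (eq_sym v x) xv vu (eq_sym u' x) xu2 (eq_sym u' u) uu' xu.
Qed.

End Uncrowded.

(** * One round *)

Section Colorings.
Variables (V C : finType) (E : {set {set V}}).
Implicit Types (phi : V -> option C) (L : V -> {set C}).

(* e can still become monochromatic in colour c. *)
Definition live phi L (e : {set V}) (c : C) :=
  [forall u in e, (phi u == Some c) || (phi u == None) && (c \in L u)].

Definition others phi (e : {set V}) (v : V) : {set V} :=
  [set u in e | (phi u == None) && (u != v)].

Definition live_at phi L v c : {set {set V}} :=
  [set e in E | (v \in e) && live phi L e c].

Definition deg phi L (i : nat) v c := #|[set e in live_at phi L v c | #|others phi e v| == i]|.

(* A fully coloured monochromatic edge is live, so the third clause also says that
   the partial colouring phi is proper. *)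
Definition reduced (R : realType) (L0 : V -> {set C}) (m : nat) (N : R) (Dg : nat -> R) :=
  exists phi L,
  [/\ forall v c, phi v = Some c -> c \in L0 v,
      forall v, L v \subset L0 v,
      forall e c, e \in E -> live phi L e c -> (1 < #|[set u in e | phi u == None]|)%N,
      forall v, phi v = None -> N <= #|L v|%:R &
      forall v c, phi v = None -> c \in L v -> forall i, (0 < i <= m)%N ->
        (deg phi L i v c)%:R <= Dg i].

Lemma liveS phi L L' e c : (forall v, L' v \subset L v) -> live phi L' e c -> live phi L e c.
Proof.
move=> LL /forall_inP h; apply/forall_inP => u ue; have /orP[->//|/andP[-> cL]] := h u ue.
by rewrite (subsetP (LL u)) ?orbT.
Qed.

(** With lists of equal size the same parameters serve at every vertex. Cutting lists can only make
    edges cease to be live, so no degree grows. *)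
Lemma reduced_trim (R : realType) L0 m (N : R) Dg (n : nat) :
  (forall j : nat, N <= j%:R -> (n <= j)%N) ->
  reduced L0 m N Dg -> exists phi L,
  [/\ forall v c, phi v = Some c -> c \in L0 v,
      forall v, L v \subset L0 v,
      forall e c, e \in E -> live phi L e c -> (1 < #|[set u in e | phi u == None]|)%N,
      forall v, phi v = None -> #|L v| = n &
      forall v c, phi v = None -> c \in L v -> forall i, (0 < i <= m)%N ->
        (deg phi L i v c)%:R <= Dg i].
Proof.
move=> Nn [phi [L [h1 h2 h3 h4 h5]]].
pose L' v := [set x in take n (enum (L v))].
have LL v : L' v \subset L v.
  by apply/subsetP => c; rewrite inE => /mem_take; rewrite mem_enum.
exists phi, L'; split=> //.
- by move=> v; apply: subset_trans (h2 v).
- by move=> e c eE /(liveS LL); apply: h3.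
- move=> v /h4 /Nn nL; rewrite cardsE; have /card_uniqP -> : uniq (take n (enum (L v))).
    by rewrite take_uniq ?enum_uniq.
  by rewrite size_takel // -cardE.
- move=> v c pv cL i im; apply: le_trans (h5 v c pv (subsetP (LL v) _ cL) i im).
  rewrite ler_nat; apply: subset_leq_card; apply/subsetP => e; rewrite !inE.
  by move=> /andP[/and3P[-> -> /(liveS LL) ->] ->].
Qed.

End Colorings.

(** * The random experiment of one round *)

Section Step.
Variables (R : realType) (V C : finType) (E : {set {set V}}) (m : nat).
Hypothesis uE : uncrowded E.
Hypothesis unifE : uniform E m.+1.
Variables (phi : V -> option C) (L : V -> {set C}) (n : nat) (Dg : nat -> R).
Hypothesis two_open : forall e c, e \in E -> live phi L e c ->
  (1 < #|[set u in e | phi u == None]|)%N.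
Hypothesis cardL : forall v, phi v = None -> #|L v| = n.
Hypothesis degD : forall v c, phi v = None -> c \in L v ->
  forall i, (0 < i <= m)%N -> (deg E phi L i v c)%:R <= Dg i.
Variables (p q : R).
Hypothesis p01 : 0 < p < 1.
Hypothesis q01 : 0 < q < 1.
Hypothesis Dpq : \sum_(1 <= i < m.+1) Dg i * p ^+ i <= 1 - q.

Local Notation open u := (phi u == None).
Local Notation rest := (others phi).
Local Notation live_at := (live_at E phi L).
Local Notation I := (V * C * bool)%type.
Local Notation Omega := {ffun I -> bool}.

Lemma rest_gt0 v c e : open v -> e \in live_at v c -> (0 < #|rest e v| <= m)%N.
Proof.
move=> pv; rewrite inE => /and3P[eE ve le].
have := two_open eE le.
rewrite (cardsD1 v) inE ve pv /= add1n ltnS => h.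
have -> : rest e v = [set u in e | open u] :\ v.
  by apply/setP => u; rewrite !inE; case: (u \in e); case: (u == v); rewrite /= ?andbT ?andbF.
rewrite h /= -ltnS -(unifE eE) (cardsD1 v e) ve add1n ltnS.
by apply: subset_leq_card; apply/subsetP => u; rewrite !inE => /and3P[-> -> _].
Qed.

Lemma live_open v c e : open v -> e \in live_at v c -> c \in L v.
Proof.
move=> /eqP pv; rewrite inE => /and3P[_ ve /forall_inP/(_ _ ve)].
by rewrite pv.
Qed.

Lemma rest_sub v e u : u \in rest e v -> [/\ u \in e, open u & u != v].
Proof. by rewrite inE => /and3P[]. Qed.

Lemma rest_live_at v c e u : e \in live_at v c -> u \in rest e v -> e \in live_at u c.
Proof. by rewrite !inE => /and3P[-> _ ->] /and3P[->]. Qed.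

(** Group the live edges by their number of open other vertices, which lies between 1 and [m] by
    [two_open] and uniformity. *)
Lemma sum_live_at v c (f : nat -> R) : open v -> c \in L v ->
  (forall i, 0 <= f i) ->
  \sum_(e in live_at v c) f #|rest e v| <= \sum_(1 <= i < m.+1) Dg i * f i.
Proof.
move=> pv cL f0.
apply: (@le_trans _ _ (\sum_(e in live_at v c)
   \sum_(1 <= i < m.+1) (if i == #|rest e v| then f i else 0))).
  apply: ler_sum => e ev; rewrite -big_mkcond big_nat1_eq ltnS.
  by rewrite (rest_gt0 pv ev).
rewrite exchange_big /= big_nat_cond [leRHS]big_nat_cond.
apply: ler_sum => i; rewrite andbT ltnS => im.
have -> : \sum_(e in live_at v c) (if i == #|rest e v| then f i else 0) =
    (deg E phi L i v c)%:R * f i.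
  rewrite -big_mkcondr mulr_natl -sumr_const.
  by apply: eq_bigl => e; rewrite !inE eq_sym.
by rewrite ler_wpM2r // degD //; apply/eqP.
Qed.

Let p0 : 0 < p. Proof. by case/andP: p01. Qed.
Let p1 : p < 1. Proof. by case/andP: p01. Qed.
Let q0 : 0 < q. Proof. by case/andP: q01. Qed.
Let q1 : q < 1. Proof. by case/andP: q01. Qed.

Let pX i : 0 <= p ^+ i <= 1.
Proof. by rewrite exprn_ge0 ?exprn_ile1 // ltW. Qed.

Lemma prod_ge1Bsum (J : finType) (P : pred J) (f : J -> R) :
  (forall j, P j -> 0 <= f j <= 1) ->
  1 - \sum_(j | P j) f j <= \prod_(j | P j) (1 - f j).
Proof.
move=> f01.
suff : 0 <= \prod_(j | P j) (1 - f j) <= 1 /\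
    1 - \sum_(j | P j) f j <= \prod_(j | P j) (1 - f j) by case.
elim/big_rec2: _ => [|j x y /f01 /andP[f0 f1] [/andP[x0 x1] xy]].
  by rewrite subr0 lexx ler01.
by split; nra.
Qed.

Definition nohit_prob (X : pred {set V}) u c : R :=
  \prod_(e | (e \in live_at u c) && ~~ X e) (1 - p ^+ #|rest e u|).

(** The first bound is the union bound [Dpq]; it makes the equalizing probability at most 1.
    Exempting one edge gains a factor at most [(1 - p)^-1], since an edge with at least one other
    open vertex hits with probability at most [p]. *)
Lemma nohit_prob_bounds u c : open u -> c \in L u ->
  q <= nohit_prob pred0 u c /\
  forall e, nohit_prob pred0 u c <= nohit_prob (pred1 e) u c <=
            nohit_prob pred0 u c / (1 - p).
Proof.
move=> pu cL.
have q_le : q <= nohit_prob pred0 u c.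
  apply: le_trans (prod_ge1Bsum _) => [|e _]; last exact: pX.
  under eq_bigl do rewrite andbT.
  suff : \sum_(e in live_at u c) p ^+ #|rest e u| <= 1 - q by lra.
  apply: le_trans Dpq; apply: (sum_live_at (f := fun i => p ^+ i)) => // i.
  by case/andP: (pX i).
split=> // e.
have r0 X : 0 <= nohit_prob X u c.
  by apply: prodr_ge0 => f _; rewrite subr_ge0; case/andP: (pX #|rest f u|).
case: (boolP (e \in live_at u c)) => eu; last first.
  have -> : nohit_prob (pred1 e) u c = nohit_prob pred0 u c.
    apply: eq_bigl => f; case: (boolP (f \in live_at u c)) => //= fu.
    by apply: contraNneq eu => <-.
  by rewrite lexx ler_pdivlMr ?subr_gt0 // ler_piMr // lerBlDr lerDl ltW.
have E1 : nohit_prob pred0 u c = (1 - p ^+ #|rest e u|) * nohit_prob (pred1 e) u c.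
  rewrite /nohit_prob (bigD1 e) ?eu //=; congr (_ * _); apply: eq_bigl => f.
  by rewrite andbT.
have /andP[s0 _] := rest_gt0 pu eu.
have ps : p ^+ #|rest e u| <= p by rewrite -[leRHS]expr1 ler_wiXn2l // ltW.
have /andP[ps0 _] := pX #|rest e u|.
rewrite E1; have := r0 (pred1 e); set y := nohit_prob _ _ _ => y0.
rewrite ler_pdivlMr ?subr_gt0 //; apply/andP; split; nra.
Qed.

(* Chosen so that every colour survives with probability exactly q. *)
Definition coin_prob u c : R :=
  if open u && (c \in L u) then q / nohit_prob pred0 u c else 0.

(* The coordinate (u, c, false) says that u picks c; (u, c, true) says that the
   equalizing coin spares c at u. *)
Definition coord_prob (x : I) : R := if x.2 then coin_prob x.1.1 x.1.2 else p.

Definition step_mu (x : I) (a : bool) : R :=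
  if a then coord_prob x else 1 - coord_prob x.

Lemma coord_prob01 x : 0 <= coord_prob x <= 1.
Proof.
rewrite /coord_prob /coin_prob; case: x.2; last by rewrite !ltW.
case: ifP => [/andP[pu cL]|_]; last by rewrite lexx ler01.
have [qr _] := nohit_prob_bounds pu cL.
have r0 := lt_le_trans q0 qr.
by rewrite divr_ge0 ?ler_pdivrMr ?mul1r // ltW.
Qed.

Lemma step_mu_ge0 x a : 0 <= step_mu x a.
Proof. by have /andP[] := coord_prob01 x; rewrite /step_mu; case: a; rewrite ?subr_ge0. Qed.

Lemma step_mu_sum1 x : \sum_a step_mu x a = 1.
Proof. by rewrite big_bool /= addrC subrK. Qed.

Local Notation Prb := (Prb step_mu).
Local Notation Exp := (Exp step_mu).

Lemma Prb_coord (x : I) : Prb (fun w => w x) = coord_prob x.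
Proof.
have := Exp_coord step_mu_sum1 x (fun b : bool => b%:R).
by rewrite big_bool /= mulr0 addr0 mulr1.
Qed.

Definition pick_at (w : Omega) u c := w (u, c, false).
Definition hit (w : Omega) e u c := [forall x in rest e u, pick_at w x c].
(* The edges in X are not allowed to delete c. *)
Definition keep (w : Omega) (X : pred {set V}) u c := w (u, c, true) &&
  [forall e, ((e \in live_at u c) && ~~ X e) ==> ~~ hit w e u c].

Lemma dep_coord (x : I) : depends_on (pred1 x) (fun w : Omega => w x).
Proof. by move=> w w' h; apply: h => /=. Qed.

Definition hit_dom e u c (x : I) := [&& x.1.1 \in rest e u, x.1.2 == c & ~~ x.2].

Lemma dep_hit e u c : depends_on (hit_dom e u c) (fun w => hit w e u c).
Proof.
move=> w w' h; apply: eq_forallb => x; case: (boolP (x \in rest e u)) => //= xe.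
by apply: h; rewrite /hit_dom /= xe eqxx.
Qed.

Lemma Prb_hit e u c : Prb (fun w => hit w e u c) = p ^+ #|rest e u|.
Proof.
rewrite (Prb_forall step_mu_sum1 (S := fun x => pred1 (x, c, false))).
- by rewrite -prodr_const; apply: eq_bigr => x _; rewrite Prb_coord.
- by move=> x _; apply: dep_coord.
- by move=> x y i _ _ /eqP -> /eqP [].
Qed.

(** Hits through different edges at [u] are independent because these edges share no vertex except
    [u]. *)
Lemma Prb_nohit (X : pred {set V}) u c :
  Prb (fun w => [forall e, ((e \in live_at u c) && ~~ X e) ==> ~~ hit w e u c]) =
  nohit_prob X u c.
Proof.
rewrite (Prb_forall step_mu_sum1 (S := fun e => hit_dom e u c)).
- by apply: eq_bigr => e _; rewrite (PrbC step_mu_sum1) Prb_hit.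
- by move=> e _; apply: (depends_on_comp negb (@dep_hit e u c)).
- move=> e f [[x c'] b]; rewrite !inE /hit_dom /= !inE.
  move=> /andP[/and3P[eE ue _] _] /andP[/and3P[fE uf _] _].
  move=> /and3P[/and3P[xe _ xu] _ _] /and3P[/and3P[xf _ _] _ _].
  apply/eqP/negPn/negP => ef; move/eqP: xu; apply.
  exact: (uncrowded_linear uE eE fE ef).
Qed.

Definition keep_dom X u c (x : I) := (x.1.2 == c) &&
  (if x.2 then x.1.1 == u
   else [exists e, [&& e \in live_at u c, ~~ X e & x.1.1 \in rest e u]]).

Lemma dep_nohit X u c : depends_on (fun x => keep_dom X u c x && ~~ x.2)
  (fun w => [forall e, ((e \in live_at u c) && ~~ X e) ==> ~~ hit w e u c]).
Proof.
move=> w w' h; apply: eq_forallb => e; case: (boolP (_ && _)) => //= /andP[eu Xe].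
congr (~~ _); apply: dep_hit => -[[x c'] b] /and3P[/= xe /eqP -> /negPf bF].
apply: h; rewrite /keep_dom /= bF eqxx /= andbT; apply/existsP; exists e.
by rewrite eu Xe xe.
Qed.

Lemma dep_keep X u c : depends_on (keep_dom X u c) (fun w => keep w X u c).
Proof.
move=> w w' h; rewrite /keep; congr (_ && _).
  by apply: h; rewrite /keep_dom /= !eqxx.
by apply: dep_nohit => x /andP[kx _]; apply: h.
Qed.

Lemma Prb_keep X u c : Prb (fun w => keep w X u c) = coin_prob u c * nohit_prob X u c.
Proof.
rewrite (Prb_and step_mu_sum1 (@dep_coord (u, c, true)) (@dep_nohit X u c)).
  by rewrite Prb_coord Prb_nohit.
by move=> x /eqP ->; rewrite /= andbF.
Qed.

Lemma Prb_keep0 u c : open u -> c \in L u -> Prb (fun w => keep w pred0 u c) = q.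
Proof.
move=> pu cL; rewrite Prb_keep /coin_prob pu cL divfK // gt_eqF //.
by apply: lt_le_trans q0 _; case: (nohit_prob_bounds pu cL).
Qed.

Definition qplus : R := q / (1 - p).

Lemma Prb_keep1 e u c : open u -> c \in L u ->
  q <= Prb (fun w => keep w (pred1 e) u c) <= qplus.
Proof.
move=> pu cL; have [qr] := nohit_prob_bounds pu cL; move=> /(_ e) /andP[r1 r2].
have r0 := lt_le_trans q0 qr.
rewrite Prb_keep /coin_prob pu cL /qplus; apply/andP; split.
  by rewrite mulrAC ler_pdivlMr // ler_pM2l.
rewrite mulrAC ler_pdivrMr // mulrAC -mulrA ler_pM2l //.
Qed.

Implicit Types (z : {set C}) (e : {set V}).

(** Exempting [e] confines the event to the branch of [u] away from [e]. *)
Definition coloured_ev e u c (w : Omega) := pick_at w u c && keep w (pred1 e) u c.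

(* z stands for the set of colours picked by the vertex v of e under consideration:
   e can delete a colour c' at another vertex u only if v picks c', so for c'
   outside z nothing is lost by exempting e. *)
Definition open_ev e (z : {set C}) u c (w : Omega) := keep w (pred1 e) u c &&
  [forall c', (c' \in L u :\: (c |: z)) ==> ~~ coloured_ev e u c' w].

Definition branch_dom e u (x : I) := branch E e u x.1.1.

Lemma keep_dom_branch e u c x : keep_dom (pred1 e) u c x -> branch_dom e u x && (x.1.2 == c).
Proof.
case: x => -[x c'] b /andP[/= -> h]; rewrite andbT /branch_dom /=; apply/branchP.
case: b h => [/eqP|/existsP[f /and3P[]]]; first by left.
rewrite !inE => /and3P[fE uf _] fe /and3P[xf _ _]; right; exists f; split=> //.
Qed.

Lemma dep_coloured e u c : depends_on (fun x => branch_dom e u x && (x.1.2 == c))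
  (coloured_ev e u c).
Proof.
move=> w w' h; rewrite /coloured_ev; congr (_ && _).
  by apply: h; rewrite /branch_dom /branch /= !eqxx.
by apply: dep_keep => x /keep_dom_branch; apply: h.
Qed.

Lemma Prb_coloured e u c : open u -> c \in L u ->
  p * q <= Prb (coloured_ev e u c) <= p * qplus.
Proof.
move=> pu cL; have /andP[k1 k2] := Prb_keep1 e pu cL.
have -> : Prb (coloured_ev e u c) = p * Prb (fun w => keep w (pred1 e) u c).
  rewrite (Prb_and step_mu_sum1 (@dep_coord (u, c, false)) (@dep_keep (pred1 e) u c)).
    by rewrite Prb_coord.
  move=> x /eqP ->; rewrite /keep_dom /= eqxx /=; apply/existsPn => f.
  by rewrite !inE eqxx !andbF.
by rewrite !ler_pM2l // k1 k2.
Qed.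

Lemma dep_open e z u c : depends_on (branch_dom e u) (open_ev e z u c).
Proof.
move=> w w' h; rewrite /open_ev; congr (_ && _).
  by apply: dep_keep => x /keep_dom_branch /andP[+ _]; apply: h.
apply: eq_forallb => c'; congr (_ ==> ~~ _).
by apply: dep_coloured => x /andP[+ _]; apply: h.
Qed.

Variable Mz : nat.

Definition stay_bound : R := (1 - p * q) ^+ (n - Mz.+1).

Let pq01 : 0 <= 1 - p * q <= 1.
Proof. by rewrite subr_ge0 lerBlDr lerDl mulr_ile1 ?mulr_ge0 // ltW. Qed.

Lemma qplus_gt0 : 0 < qplus.
Proof. by rewrite divr_gt0 // subr_gt0. Qed.

Lemma stay_bound_ge0 : 0 <= stay_bound.
Proof. by rewrite exprn_ge0 //; case/andP: pq01. Qed.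

(** The survival of [c] and the failure of the other colours involve different colours, hence
    disjoint coordinates; this is why [c] itself is left out of the second part. At least
    [n - Mz.+1] colours remain there, each independently taken with probability at least [p * q]. *)
Lemma Prb_open e z u c : open u -> c \in L u -> (#|z| <= Mz)%N ->
  Prb (open_ev e z u c) <= qplus * stay_bound.
Proof.
move=> pu cL zM; have /andP[k1 k2] := Prb_keep1 e pu cL.
pose F w := [forall c', (c' \in L u :\: (c |: z)) ==> ~~ coloured_ev e u c' w].
have dF : depends_on (fun x => x.1.2 != c) F.
  move=> w w' h; apply: eq_forallb => c'.
  case: (boolP (c' \in _)) => //= c'z; congr (~~ _).
  apply: dep_coloured => x /andP[_ /eqP xc]; apply: h; rewrite xc.
  by move: c'z; rewrite !inE negb_or => /andP[/andP[-> _] _].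
have dK : depends_on (fun x => x.1.2 == c) (fun w => keep w (pred1 e) u c).
  by move=> w w' h; apply: dep_keep => x /andP[+ _]; apply: h.
rewrite (Prb_and step_mu_sum1 dK dF); last by move=> x /= ->.
apply: ler_pM; rewrite ?Prb_ge0 //; try exact: step_mu_ge0.
rewrite (Prb_forall step_mu_sum1 (S := fun c' x => x.1.2 == c')); first last.
- by move=> c1 c2 i _ _ /eqP -> /eqP ->.
- move=> c' _; apply: (depends_on_comp negb (f := coloured_ev e u c')).
  by move=> w w' h; apply: dep_coloured => x /andP[_ +]; apply: h.
apply: (@le_trans _ _ (\prod_(c' in L u :\: (c |: z)) (1 - p * q))).
  apply: ler_prod => c' c'L; rewrite Prb_ge0 ?(PrbC step_mu_sum1) /=; last exact: step_mu_ge0.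
  have c'Lu : c' \in L u by move: c'L; rewrite inE => /andP[].
  by rewrite lerB //; case/andP: (Prb_coloured e pu c'Lu).
rewrite prodr_const; apply: ler_wiXn2l; rewrite ?(andP pq01).1 ?(andP pq01).2 //.
rewrite -(cardL (eqP pu)) leq_subLR -(cardsID (c |: z) (L u)) leq_add2r.
apply: leq_trans (subset_leq_card (subsetIr _ _)) _.
by apply: leq_trans (leq_card_setU _ _).1 _; rewrite cards1 add1n ltnS.
Qed.

(** [Q] is the set of other vertices staying open. This only has to be implied by the true outcome
    for [e]; in exchange, for fixed [z], it lives on the branches of the vertices of [e]. *)
Definition edge_ev (z : {set C}) v i e c (w : Omega) :=
  [exists Q : {set V}, ((Q \subset rest e v) && (#|Q| == i)) &&
    [forall u, (u \in rest e v) ==>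
       if u \in Q then open_ev e z u c w else coloured_ev e u c w]].

Definition edge_dom e v (x : I) := [exists u, (u \in rest e v) && branch_dom e u x].

Lemma dep_edge_ev z v i e c : depends_on (edge_dom e v) (edge_ev z v i e c).
Proof.
move=> w w' h; apply: eq_existsb => Q; congr (_ && _); apply: eq_forallb => u.
case: (boolP (u \in rest e v)) => //= ue; case: ifP => _.
  by apply: dep_open => x bx; apply: h; apply/existsP; exists u; rewrite ue.
by apply: dep_coloured => x /andP[bx _]; apply: h; apply/existsP; exists u; rewrite ue.
Qed.

Lemma rest_open v c e u : e \in live_at v c -> u \in rest e v -> c \in L u.
Proof.
move=> ev ue; have eu := rest_live_at ev ue; apply: (live_open _ eu).
by case: (rest_sub ue).
Qed.

(** A union bound over [Q]; for fixed [Q] the vertices of [e] are independent, by [branch_disjoint]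
    with both edges equal to [e]. *)
Lemma Prb_edge_ev z v i e c : e \in live_at v c -> (#|z| <= Mz)%N ->
  Prb (edge_ev z v i e c) <=
  'C(#|rest e v|, i)%:R * (qplus * stay_bound) ^+ i * (p * qplus) ^+ (#|rest e v| - i).
Proof.
move=> ev zM; apply: le_trans (Prb_exists step_mu_ge0 _ _) _.
apply: (@le_trans _ _ (\sum_(Q : {set V} | (Q \subset rest e v) && (#|Q| == i))
    (qplus * stay_bound) ^+ i * (p * qplus) ^+ (#|rest e v| - i))); last first.
  by rewrite sumr_const -cards_draws -mulrA mulr_natl [X in _ <= _ *+ X]cardsE.
apply: ler_sum => Q /andP[Qr /eqP Qi].
have [eE ve _] : [/\ e \in E, v \in e & live phi L e c].
  by move: ev; rewrite inE => /and3P.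
rewrite (Prb_forall step_mu_sum1 (S := fun u => branch_dom e u)); first last.
- move=> u u' x /rest_sub[ue _ uv] /rest_sub[u'e _ u'v].
  exact: (branch_disjoint uE eE eE ve ve).
- move=> u _; case: (u \in Q); first exact: dep_open.
  by move=> w w' h; apply: dep_coloured => x /andP[+ _]; apply: h.
rewrite (bigID (mem Q)) /=; apply: ler_pM.
- by apply: prodr_ge0 => u _; apply: Prb_ge0; apply: step_mu_ge0.
- by apply: prodr_ge0 => u _; apply: Prb_ge0; apply: step_mu_ge0.
- rewrite -Qi -prodr_const [leRHS](eq_bigl (fun u => (u \in rest e v) && (u \in Q))).
    apply: ler_prod => u /andP[ur uQ]; rewrite uQ Prb_ge0 //=; last exact: step_mu_ge0.
    by apply: Prb_open => //; [case: (rest_sub ur) | apply: rest_open ur].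
  by move=> u; case: (boolP (u \in Q)) => [uQ|]; rewrite ?andbF // andbT (subsetP Qr).
- rewrite -Qi -cardsDS // -prodr_const.
  rewrite [leRHS](eq_bigl (fun u => (u \in rest e v) && (u \notin Q))).
    apply: ler_prod => u /andP[ur /negPf uQ]; rewrite uQ Prb_ge0 //=; last exact: step_mu_ge0.
    apply: (proj2 (andP (Prb_coloured _ _ _))) => //; last exact: rest_open ur.
    by case: (rest_sub ur).
  by move=> u; rewrite inE andbC.
Qed.

Variables (th : R) (mean Dg' : nat -> R).
Hypothesis th01 : 0 <= th <= 2^-1.
Hypothesis mean_ge : forall i, (0 < i <= m)%N ->
  \sum_(1 <= j < m.+1) Dg j *
    ('C(j, i)%:R * (qplus * stay_bound) ^+ i * (p * qplus) ^+ (j - i)) <= mean i.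
Hypothesis Dg'_ge : forall i, (0 < i <= m)%N -> (1 + 3 * th) * mean i <= Dg' i.

Definition edge_count z v i c (w : Omega) :=
  #|[pred e | (e \in live_at v c) && edge_ev z v i e c w]|.

Lemma dep_edge_count z v i c : depends_on (fun x => x.1.1 != v) (edge_count z v i c).
Proof.
move=> w w' h; apply: eq_card => e; rewrite !inE.
case: (boolP [&& e \in E, v \in e & live phi L e c]) => //= /and3P[eE ve _].
apply: dep_edge_ev => x /existsP[u /andP[/rest_sub[ue _ uv] bx]]; apply: h.
by apply: contraL bx => /eqP xv; rewrite /branch_dom xv (branch_root uE eE).
Qed.

Lemma Prb_edge_count z v i c : open v -> c \in L v -> (0 < i <= m)%N -> (#|z| <= Mz)%N ->
  Prb (fun w => Dg' i <= (edge_count z v i c w)%:R) <= expR (- (th ^+ 2 * mean i)).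
Proof.
move=> pv cL im zM.
apply: (chernoff_upper step_mu_ge0 step_mu_sum1 (S := fun e => edge_dom e v)) (th01) _ (Dg'_ge im).
- by move=> e _; apply: dep_edge_ev.
- move=> e e' x; rewrite !inE => /and3P[eE ve _] /and3P[e'E ve' _].
  move=> /existsP[u /andP[/rest_sub[ue _ uv] bx]].
  move=> /existsP[u' /andP[/rest_sub[ue' _ uv'] bx']].
  have uu : u = u' by apply: (branch_disjoint uE eE e'E ve ve' ue ue' uv uv' bx bx').
  apply/eqP/negPn/negP => ee; move/eqP: uv; apply.
  by apply: (uncrowded_linear uE eE e'E) => //; rewrite uu.
apply: le_trans (mean_ge im).
pose f j := 'C(j, i)%:R * (qplus * stay_bound) ^+ i * (p * qplus) ^+ (j - i).
apply: le_trans (sum_live_at (f := f) pv cL _) => [|j]; last first.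
  have q0' := ltW qplus_gt0; have p0' := ltW p0; have s0 := stay_bound_ge0.
  apply: mulr_ge0; last by apply: exprn_ge0; apply: mulr_ge0.
  by apply: mulr_ge0; [exact: ler0n | apply: exprn_ge0; apply: mulr_ge0].
by apply: ler_sum => e ev; apply: Prb_edge_ev.
Qed.

Definition picks (w : Omega) v := [set c in L v | pick_at w v c].

Lemma dep_picks v : depends_on (fun x => x.1.1 == v) (fun w => picks w v).
Proof.
move=> w w' h; apply/setP => c; rewrite !inE; congr (_ && _).
by apply: h; rewrite /= eqxx.
Qed.

(** Split by the value [z] of [picks w v]. For fixed [z] the count avoids all coordinates at [v], so
    each part factors, and the probabilities of the values of [z] add up to at most 1. *)
Lemma Prb_edge_count_picks v i c : open v -> c \in L v -> (0 < i <= m)%N ->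
  Prb (fun w => (#|picks w v| <= Mz)%N && (Dg' i <= (edge_count (picks w v) v i c w)%:R))
  <= expR (- (th ^+ 2 * mean i)).
Proof.
move=> pv cL im.
apply: (@le_trans _ _ (Prb (fun w => [exists z : {set C}, (#|z| <= Mz)%N &&
   ((picks w v == z) && (Dg' i <= (edge_count z v i c w)%:R))]))).
  apply: (le_Prb step_mu_ge0) => w /andP[zM h]; apply/existsP; exists (picks w v).
  by rewrite zM eqxx.
apply: le_trans (Prb_exists step_mu_ge0 _ _) _.
apply: (@le_trans _ _ (\sum_(z : {set C} | (#|z| <= Mz)%N)
    Prb (fun w => picks w v == z) * expR (- (th ^+ 2 * mean i)))).
  apply: ler_sum => z zM.
  rewrite (Prb_and step_mu_sum1 (S := fun x => x.1.1 == v) (S' := fun x => x.1.1 != v)).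
  - by rewrite ler_wpM2l ?Prb_edge_count // Prb_ge0 //; apply: step_mu_ge0.
  - exact: (depends_on_comp (fun y => y == z) (@dep_picks v)).
  - exact: (depends_on_comp (fun y : nat => Dg' i <= y%:R) (@dep_edge_count z v i c)).
  - by move=> x ->.
rewrite -mulr_suml ler_piMl ?expR_ge0 //.
apply: (@le_trans _ _ (\sum_(z : {set C}) Prb (fun w => picks w v == z))).
  rewrite big_mkcond /=; apply: ler_sum => z _; case: ifP => // _.
  by apply: Prb_ge0; apply: step_mu_ge0.
rewrite -Exp_sum -[leRHS](Exp_cst step_mu_sum1).
rewrite le_eqVlt; apply/orP; left; apply/eqP; apply: eq_Exp => w.
rewrite (bigD1 (picks w v)) //= eqxx big1 ?addr0 // => z /negPf.
by rewrite eq_sym => ->.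
Qed.

Lemma Prb_many_picks v : open v -> 5 / 2 * (p * n%:R) <= Mz.+1%:R ->
  Prb (fun w => (Mz < #|picks w v|)%N) <= expR (- (Mz.+1%:R / 10)).
Proof.
move=> pv pM.
(* Chernoff with [t = 2^-1]: the factor [1 + 3 * t = 5 / 2] turns the mean bound [Mz.+1 * (2 / 5)]
   into the threshold [Mz.+1]. *)
have -> : - (Mz.+1%:R / 10) = - ((2^-1) ^+ 2 * (Mz.+1%:R * (2 / 5))) :> R by field.
have H := @chernoff_upper _ _ _ _ step_mu_ge0 step_mu_sum1 C (mem (L v))
  (fun c => pred1 (v, c, false)) (fun c w => pick_at w v c) _ _
  2^-1 (Mz.+1%:R * (2 / 5)) Mz.+1%:R.
apply: le_trans (H _ _ _ _ _).
- apply: (le_Prb step_mu_ge0) => w; rewrite ler_nat => /leq_trans; apply.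
  by apply: subset_leq_card; apply/subsetP => c; rewrite !inE.
- by move=> c _; apply: dep_coord.
- by move=> c c' x _ _ /eqP -> /eqP[].
- by apply/andP; split; lra.
- under eq_bigr do rewrite Prb_coord.
  by rewrite sumr_const cardL ?(eqP pv) //= /coord_prob /= -mulr_natr; lra.
- lra.
Qed.

Lemma Prb_short_list v a : open v -> a <= (1 - 2 * th) * (q * n%:R) ->
  Prb (fun w => #|[set c in L v | keep w pred0 v c]|%:R <= a) <=
  expR (- (th ^+ 2 * (q * n%:R))).
Proof.
move=> pv aq.
have H := @chernoff_lower _ _ _ _ step_mu_ge0 step_mu_sum1 C (mem (L v))
  (fun c x => x.1.2 == c) (fun c w => keep w pred0 v c) _ _ th (q * n%:R) a.
apply: le_trans (H _ _ _ _ _ _).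
- apply: (le_Prb step_mu_ge0) => w; rewrite (_ : #|_| = #|[pred c | (c \in L v) && keep w pred0 v c]|) //.
  by apply: eq_card => c; rewrite !inE.
- by move=> c _ w w' h; apply: dep_keep => x /andP[+ _]; apply: h.
- by move=> c c' x _ _ /eqP -> /eqP.
- by case/andP: th01.
- rewrite (eq_bigr (fun=> q)) => [|c cL]; last exact: Prb_keep0.
  by rewrite sumr_const cardL ?(eqP pv) //= mulr_natr.
- by [].
- by rewrite mulr_ge0 // ltW.
Qed.


(** * Locality of the bad events *)

Definition nbhd (v : V) : {set V} := [set u | (u == v) ||
  [&& open v, open u & [exists c, exists e in live_at v c, u \in e]]].

Definition ball2 (v : V) : {set V} := \bigcup_(u in nbhd v) nbhd u.

Lemma nbhd_sym u v : u \in nbhd v -> v \in nbhd u.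
Proof.
rewrite !inE eq_sym => /orP[->//|/and3P[pv pu /existsP[c /exists_inP[e]]]].
rewrite inE => /and3P[eE ve le] ue; apply/orP; right; rewrite pu pv /=.
by apply/existsP; exists c; apply/exists_inP; exists e; rewrite // inE eE ue.
Qed.

Lemma nbhd_open u v : open v -> u \in nbhd v -> open u.
Proof. by move=> pv; rewrite inE => /orP[/eqP->|/and3P[]]. Qed.

Lemma nbhd_rest v c e u : open v -> e \in live_at v c -> u \in rest e v -> u \in nbhd v.
Proof.
move=> pv ev /rest_sub[ue pu _]; rewrite inE pv pu; apply/orP; right.
by apply/existsP; exists c; apply/exists_inP; exists e.
Qed.

Lemma nbhd_self v : v \in nbhd v.
Proof. by rewrite inE eqxx. Qed.

Lemma nbhd_ball2 v u : u \in nbhd v -> u \in ball2 v.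
Proof. by move=> uv; apply/bigcupP; exists v => //; apply: nbhd_self. Qed.

Lemma card_bigcup_le (T1 T2 : finType) (A : {set T1}) (F : T1 -> {set T2}) (b : R) :
  (forall x, x \in A -> #|F x|%:R <= b) -> #|\bigcup_(x in A) F x|%:R <= #|A|%:R * b.
Proof.
move=> Fb; apply: (@le_trans _ _ (\sum_(x in A) #|F x|%:R)).
  elim/big_rec2: _ => [|x y B xA By]; first by rewrite cards0.
  apply: (@le_trans _ _ (#|F x| + #|B|)%:R); last by rewrite natrD lerD2l.
  by rewrite ler_nat; case: (leq_card_setU (F x) B).
by rewrite -sum1_card natr_sum mulr_suml; apply: ler_sum => x xA; rewrite mul1r Fb.
Qed.

Variable b : R.
Hypothesis b_ge : 1 + n%:R * (m.+1%:R * \sum_(1 <= i < m.+1) Dg i) <= b.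

(** Count [n] colours, at most [\sum Dg i] live edges for each, and [m.+1] vertices for each edge.
    Only live edges have bounded degrees, so only they define neighbours. *)
Lemma card_nbhd v : open v -> #|nbhd v|%:R <= b.
Proof.
move=> pv; apply: le_trans b_ge.
pose F c := \bigcup_(e in live_at v c) e.
have : (#|nbhd v| <= 1 + #|\bigcup_(c in L v) F c|)%N.
  rewrite -(cards1 v); apply: leq_trans (leq_card_setU _ _).1.
  apply: subset_leq_card; apply/subsetP => u; rewrite !inE => /orP[->//|].
  move=> /and3P[_ pu /existsP[c /exists_inP[e ev ue]]]; apply/orP; right.
  apply/bigcupP; exists c; first exact: live_open ev.
  by apply/bigcupP; exists e.
rewrite -(ler_nat R) natrD => /le_trans; apply; rewrite lerD2l.
rewrite -(cardL (eqP pv)); apply: card_bigcup_le => c cL.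
have /le_trans -> // : #|F c|%:R <= #|live_at v c|%:R * m.+1%:R :> R.
  by apply: card_bigcup_le => e; rewrite inE => /and3P[eE _ _]; rewrite unifE.
rewrite mulrC ler_wpM2l // -sum1_card natr_sum.
apply: le_trans (sum_live_at (f := fun=> 1) pv cL _) _ => //.
by apply: ler_sum => i _; rewrite mulr1.
Qed.

(** Balls of radius two that meet have centres at distance at most four. *)
Lemma card_conflicts v : open v ->
  #|[set v' | open v' && [exists x, (x \in ball2 v) && (x \in ball2 v')]]|%:R <= b ^+ 4.
Proof.
move=> pv.
pose B2 := ball2 v; pose B3 := \bigcup_(u in B2) nbhd u; pose B4 := \bigcup_(u in B3) nbhd u.
have o2 u : u \in B2 -> open u.
  by move=> /bigcupP[x xv ux]; apply: nbhd_open ux; apply: nbhd_open xv.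
have o3 u : u \in B3 -> open u.
  by move=> /bigcupP[x /o2 xv ux]; apply: nbhd_open ux.
have b0 : 0 <= b by apply: le_trans (card_nbhd pv).
apply: (@le_trans _ _ #|B4|%:R).
  rewrite ler_nat; apply: subset_leq_card; apply/subsetP => v'.
  rewrite inE => /andP[pv' /existsP[x /andP[x2 /bigcupP[y yv' xy]]]].
  apply/bigcupP; exists y; last exact: nbhd_sym.
  by apply/bigcupP; exists x => //; apply: nbhd_sym.
have c2 : #|B2|%:R <= b ^+ 2.
  apply: (@le_trans _ _ (#|nbhd v|%:R * b)).
    by apply: card_bigcup_le => u uv; apply: card_nbhd; apply: nbhd_open uv.
  by rewrite expr2 ler_wpM2r // card_nbhd.
have c3 : #|B3|%:R <= b ^+ 3.
  apply: (@le_trans _ _ (#|B2|%:R * b)).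
    by apply: card_bigcup_le => u /o2; apply: card_nbhd.
  by rewrite exprSr ler_wpM2r.
apply: (@le_trans _ _ (#|B3|%:R * b)).
  by apply: card_bigcup_le => u /o3; apply: card_nbhd.
by rewrite exprSr ler_wpM2r.
Qed.

Definition kept (w : Omega) v := [set c in L v | keep w pred0 v c].

Variable N' : R.
Hypothesis N'_le : N' <= (1 - 2 * th) * (q * n%:R).

Definition bad_count v (w : Omega) (ic : 'I_m.+1 * C) :=
  (#|picks w v| <= Mz)%N && (Dg' ic.1 <= (edge_count (picks w v) v ic.1 ic.2 w)%:R).

Definition bad v (w : Omega) := open v &&
  [|| #|kept w v|%:R <= N', (Mz < #|picks w v|)%N |
      [exists ic : 'I_m.+1 * C, (0 < ic.1)%N && (ic.2 \in L v) && bad_count v w ic]].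

Definition bad_dom v (x : I) := open v && (x.1.1 \in ball2 v).

Lemma keep_dom_nbhd X u c x : open u -> keep_dom X u c x -> x.1.1 \in nbhd u.
Proof.
move=> pu /andP[_]; case: ifP => _ => [/eqP->|/existsP[e /and3P[eu _ xe]]].
  exact: nbhd_self.
exact: nbhd_rest eu xe.
Qed.

(** The degrees at [v] depend on which colours survive at its neighbours, and this depends on picks
    at their neighbours: hence radius two. *)
Lemma dep_bad v : depends_on (bad_dom v) (bad v).
Proof.
move=> w w' h; rewrite /bad; case: (boolP (open v)) => //= pv.
have hh x : x.1.1 \in ball2 v -> w x = w' x by move=> xv; apply: h; rewrite /bad_dom pv.
have Z : picks w v = picks w' v.
  by apply: dep_picks => x /eqP xv; apply: hh; rewrite xv nbhd_ball2 ?nbhd_self.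
rewrite -Z; congr [|| _ <= _, _ | _].
  congr (_%:R); apply: eq_card => c; rewrite !inE; congr (_ && _).
  by apply: dep_keep => x kx; apply: hh; apply: nbhd_ball2; apply: keep_dom_nbhd kx.
apply: eq_existsb => -[i c]; congr (_ && _); rewrite /bad_count -Z; congr (_ && (_ <= _%:R)).
apply: eq_card => e; rewrite !inE.
case: (boolP [&& e \in E, v \in e & live phi L e c]) => //= ev.
have ev' : e \in live_at v c by rewrite inE.
have kk u c' X : u \in rest e v -> keep w X u c' = keep w' X u c'.
  move=> ue; have pu : open u by case: (rest_sub ue).
  apply: dep_keep => x kx; apply: hh; apply/bigcupP; exists u.
    exact: (nbhd_rest pv ev' ue).
  exact: keep_dom_nbhd kx.
have cc u c' : u \in rest e v -> coloured_ev e u c' w = coloured_ev e u c' w'.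
  move=> ue; rewrite /coloured_ev kk //; congr (_ && _); apply: hh.
  by apply: nbhd_ball2; exact: (nbhd_rest pv ev' ue).
apply: eq_existsb => Q; congr (_ && _); apply: eq_forallb => u.
case: (boolP (u \in rest e v)) => //= ue; case: ifP => _; last exact: cc.
rewrite /open_ev kk //; congr (_ && _); apply: eq_forallb => c'; congr (_ ==> ~~ _).
exact: cc.
Qed.

Hypothesis Mz_ge : 5 / 2 * (p * n%:R) <= Mz.+1%:R.
Variable fail : R.
Hypothesis fail_ge : expR (- (th ^+ 2 * (q * n%:R))) + expR (- (Mz.+1%:R / 10)) +
  n%:R * \sum_(1 <= i < m.+1) expR (- (th ^+ 2 * mean i)) <= fail.
Hypothesis fail_le : b ^+ 4 * fail <= 4^-1.

Lemma Prb_bad v : open v -> Prb (bad v) <= fail.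
Proof.
move=> pv; apply: le_trans fail_ge.
apply: (@le_trans _ _ (Prb (fun w => (#|kept w v|%:R <= N') || ((Mz < #|picks w v|)%N ||
   [exists ic : 'I_m.+1 * C, (0 < ic.1)%N && (ic.2 \in L v) && bad_count v w ic])))).
  by apply: (le_Prb step_mu_ge0) => w /andP[].
apply: le_trans (PrbU step_mu_ge0 _ _) _; rewrite -addrA; apply: lerD.
  exact: Prb_short_list.
apply: le_trans (PrbU step_mu_ge0 _ _) _; apply: lerD; first exact: Prb_many_picks.
apply: le_trans (Prb_exists step_mu_ge0 _ _) _.
apply: (@le_trans _ _ (\sum_(ic : 'I_m.+1 * C | (0 < ic.1)%N && (ic.2 \in L v))
   expR (- (th ^+ 2 * mean ic.1)))).
  apply: ler_sum => -[i c] /= /andP[i0 cL]; apply: Prb_edge_count_picks => //.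
  by rewrite i0 -ltnS ltn_ord.
rewrite -(pair_big (fun i : 'I_m.+1 => (0 < i)%N) (mem (L v))
  (fun i _ => expR (- (th ^+ 2 * mean i)))) /=.
under eq_bigr do rewrite sumr_const (cardL (eqP pv)) -mulr_natl.
rewrite -mulr_sumr ler_wpM2l // big_add1 /= big_mkord big_mkcond big_ord_recl /= add0r.
by [].
Qed.

Lemma b_ge1 v : open v -> 1 <= b.
Proof.
move=> pv; apply: le_trans (card_nbhd pv); rewrite ler1n.
by apply/card_gt0P; exists v; apply: nbhd_self.
Qed.

Lemma exists_good : exists w, forall v, ~~ bad v w.
Proof.
have f0 v : open v -> 0 <= fail.
  by move=> /Prb_bad; apply: le_trans; apply: Prb_ge0; apply: step_mu_ge0.
have closed v : ~~ open v -> Prb (bad v) = 0.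
  move=> /negPf pv; rewrite -[RHS](Exp_cst step_mu_sum1).
  by apply: eq_Exp => w; rewrite /bad pv.
suff [w _ wg] : exists2 w, 0 < weight step_mu w & forall v, ~~ bad v w by exists w.
apply: (local_lemma step_mu_ge0 step_mu_sum1 dep_bad) => v.
  case: (boolP (open v)) => [pv|/closed -> //]; apply: le_trans fail_le.
  apply: le_trans (Prb_bad pv) _; rewrite ler_peMl ?f0 // ?(f0 v) //.
  by rewrite exprn_ege1 // (b_ge1 pv).
case: (boolP (open v)) => [pv|pv]; last first.
  rewrite big_pred0 // => v'; apply/existsP => -[x]; rewrite /bad_dom (negPf pv) //.
apply: le_trans fail_le.
rewrite (bigID (fun v' => open v')) /= [X in _ + X]big1 ?addr0; last first.
  by move=> v' /andP[_ /closed].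
apply: (@le_trans _ _ (\sum_(v' | v' \in [set v' | open v' &&
    [exists x, (x \in ball2 v) && (x \in ball2 v')]]) fail)); last first.
  by rewrite sumr_const -mulr_natl ler_wpM2r ?(f0 v) // card_conflicts.
apply: (@le_trans _ _ (\sum_(v' | [exists i, bad_dom v i && bad_dom v' i] && open v') fail)).
  by apply: ler_sum => v' /andP[_ /Prb_bad].
rewrite [leLHS]big_mkcond [leRHS]big_mkcond; apply: ler_sum => v' _.
case: ifP => [/andP[/existsP[x /andP[/andP[_ x1] /andP[_ x2]]] pv']|_].
  by rewrite inE pv' /= (_ : [exists _, _]) //; apply/existsP; exists x.1.1; rewrite x1 x2.
by case: ifP => // _; apply: (f0 v).
Qed.

(** * The partial colouring obtained from a good outcome *)

Definition new_colour (w : Omega) v : option C :=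
  if phi v is Some c then Some c else [pick c in L v | pick_at w v c && keep w pred0 v c].

Lemma new_colourP w v c : new_colour w v = Some c ->
  phi v = Some c \/ [/\ phi v = None, c \in L v, pick_at w v c & keep w pred0 v c].
Proof.
rewrite /new_colour; case: (phi v) => [c'|]; first by left.
by case: pickP => // c' /and3P[? ? ?] [<-]; right.
Qed.

Lemma new_colourN w v : new_colour w v = None -> phi v = None.
Proof. by rewrite /new_colour; case: (phi v). Qed.

Lemma kept_sub w v : kept w v \subset L v.
Proof. by apply/subsetP => c; rewrite inE => /andP[]. Qed.

Lemma live_new w e c : live (new_colour w) (kept w) e c -> live phi L e c.
Proof.
move=> /forall_inP h; apply/forall_inP => u /h /orP[/eqP/new_colourP[->|]|].
- by rewrite eqxx.
- by case=> -> cL _ _; rewrite /= cL.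
- by case/andP=> /eqP/new_colourN -> /(subsetP (kept_sub w u)) ->.
Qed.

Lemma keep_blocked w e v c : e \in E -> live phi L e c -> v \in e -> open v ->
  (forall u, u \in rest e v -> pick_at w u c) -> ~~ keep w pred0 v c.
Proof.
move=> eE le ve pv h; apply/negP => /andP[_ /forallP /(_ e)].
rewrite inE eE ve le /= => /negP; apply; apply/forall_inP => u; exact: h.
Qed.

(** Otherwise some previously open [v] in [e] has all other open vertices of [e] newly coloured [c],
    so all of them picked [c]. Then [e] deletes [c] at [v], while liveness requires that [c]
    survived there. *)
Lemma two_open_new w e c : e \in E -> live (new_colour w) (kept w) e c ->
  (1 < #|[set u in e | new_colour w u == None]|)%N.
Proof.
move=> eE le; have le0 := live_new le; rewrite ltnNge; apply/negP => le1.
have [v [ve pv vN]] : exists v, [/\ v \in e, open v &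
    forall u, u \in rest e v -> new_colour w u != None].
  have [z0|[v]] := set_0Vmem [set u in e | new_colour w u == None].
    have := two_open eE le0; case/ltnW/card_gt0P => v; rewrite inE => /andP[ve pv].
    exists v; split=> // u /rest_sub[ue _ _]; apply/negP => un.
    by have := in_set0 u; rewrite -z0 inE ue un.
  rewrite inE => /andP[ve vn]; exists v; split=> //.
    by apply/eqP; apply: new_colourN (eqP vn).
  move=> u /rest_sub[ue _ uv]; apply/negP => un; move/negP: uv; apply; apply/eqP.
  by apply: (card_le1_eqP le1); rewrite inE ?ue ?ve.
have pk u : u \in rest e v -> pick_at w u c.
  move=> ur; have := vN u ur; have [ue pu _] := rest_sub ur.
  have /orP[/eqP/new_colourP[pu'|[]//]|/andP[/eqP->//]] := forall_inP le u ue.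
  by rewrite pu' in pu.
have := keep_blocked eE le0 ve pv pk.
have /orP[/eqP/new_colourP[pv'|[_ _ _ ->//]]|] := forall_inP le v ve.
  by rewrite pv' in pv.
by case/andP=> _; rewrite inE => /andP[_ ->].
Qed.

Lemma edge_ev_new w v c e : open v -> c \in L v ->
  e \in E -> v \in e -> live (new_colour w) (kept w) e c ->
  edge_ev (picks w v) v #|others (new_colour w) e v| e c w.
Proof.
move=> pv cL eE ve le; have le0 := live_new le.
have ev : e \in live_at v c by rewrite inE eE ve.
have k1 u c' : keep w pred0 u c' -> keep w (pred1 e) u c'.
  case/andP=> k0 /forallP h; rewrite /keep k0 /=; apply/forallP => f.
  by apply/implyP => /andP[fu _]; have := h f; rewrite fu.
apply/existsP; exists (others (new_colour w) e v); rewrite eqxx andbT; apply/andP; split.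
  by apply/subsetP => u; rewrite !inE => /and3P[-> /eqP/new_colourN -> ->].
apply/forall_inP => u ur; have [ue pu uv] := rest_sub ur.
have /orP[/eqP un|/andP[/eqP un cu]] := forall_inP le u ue.
  rewrite inE un /= andbF; case: (new_colourP un) => [pu'|[_ _ pk kp]].
    by rewrite pu' in pu.
  by rewrite /coloured_ev pk k1.
rewrite inE ue un uv /=; apply/andP; split.
  by apply: k1; move: cu; rewrite inE => /andP[].
apply/forall_inP => c'; rewrite !inE negb_or negb_and => /andP[/andP[_ c'z] c'u].
(* Suppose [u] picks a colour [c'] outside the picks of [v] and no edge except possibly [e] deletes
   it. To delete it, [e] would need [v] to pick it; so [c'] survives and [u] cannot have stayed
   open. *)
apply/negP => /andP[pk /andP[k0 /forallP kf]].
have : keep w pred0 u c'.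
  rewrite /keep k0; apply/forallP => f; apply/implyP; rewrite andbT => fu.
  case: (eqVneq f e) => [fe|fe]; last by have := kf f; rewrite fu fe.
  rewrite fe in fu *; apply/negP => /forall_inP /(_ v) hv.
  have vr : v \in rest e u by rewrite inE ve pv eq_sym.
  have c'v : c' \in L v.
    apply: (live_open pv (e := e)); move: fu; rewrite !inE => /and3P[-> _ ->].
    by rewrite ve.
  by move: c'z; rewrite c'v hv.
move: un; rewrite /new_colour (eqP pu); case: pickP => // /(_ c').
by rewrite c'u pk /= => ->.
Qed.

Theorem step_reduced (L0 : V -> {set C}) :
  (forall v c, phi v = Some c -> c \in L0 v) -> (forall v, L v \subset L0 v) ->
  reduced E L0 m N' Dg'.
Proof.
move=> phiL0 LL0; have [w wg] := exists_good.
exists (new_colour w), (kept w); split.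
- by move=> v c /new_colourP[/phiL0//|[_ cL _ _]]; apply: (subsetP (LL0 v)).
- by move=> v; apply: subset_trans (LL0 v); apply: kept_sub.
- by move=> e c; apply: two_open_new.
- move=> v /new_colourN pv; have := wg v; rewrite /bad pv /= !negb_or -ltNge.
  by case/andP=> /ltW.
- move=> v c /new_colourN/eqP pv cv i im; have := wg v; rewrite /bad pv /= !negb_or.
  case/and3P=> _; rewrite -leqNgt => zM /existsPn /(_ (inord i, c)).
  have cL := subsetP (kept_sub w v) _ cv.
  rewrite /bad_count /= inordK; last by case/andP: im; rewrite ltnS.
  rewrite (andP im).1 cL zM /= -ltNge => /ltW; apply: le_trans.
  rewrite ler_nat; apply: subset_leq_card; apply/subsetP => e; rewrite !inE.
  move=> /andP[/and3P[eE ve le] /eqP <-].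
  by rewrite eE ve (live_new le) edge_ev_new.
Qed.

End Step.

(** * The last round *)

Section Finish.
Variables (R : realType) (V C : finType) (E : {set {set V}}) (m : nat).
Hypothesis unifE : uniform E m.+1.
Variables (phi : V -> option C) (L : V -> {set C}) (n : nat) (Dg : nat -> R).
Hypothesis two_open : forall e c, e \in E -> live phi L e c ->
  (1 < #|[set u in e | phi u == None]|)%N.
Hypothesis cardL : forall v, phi v = None -> #|L v| = n.
Hypothesis degD : forall v c, phi v = None -> c \in L v ->
  forall i, (0 < i <= m)%N -> (deg E phi L i v c)%:R <= Dg i.
Hypothesis Dg_ge0 : forall i, 0 <= Dg i.
Hypothesis n_gt0 : (0 < n)%N.
Hypothesis small : m.+1%:R * \sum_(1 <= i < m.+1) Dg i * n%:R^-1 ^+ i <= 4^-1.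

Local Notation open u := (phi u == None).

(** Coloured vertices carry a point mass, so that one product measure describes the whole
    colouring. *)
Definition finish_mu (v : V) (a : C) : R :=
  if phi v is Some c then (a == c)%:R else if a \in L v then n%:R^-1 else 0.

Lemma finish_mu_ge0 v a : 0 <= finish_mu v a.
Proof. by rewrite /finish_mu; case: (phi v) => // ; case: ifP; rewrite ?invr_ge0. Qed.

Lemma finish_mu_sum1 v : \sum_a finish_mu v a = 1.
Proof.
rewrite /finish_mu; case pv: (phi v) => [c|].
  by rewrite (bigD1 c) //= eqxx big1 ?addr0 // => a /negPf ->.
rewrite -big_mkcond sumr_const (cardL pv) -[LHS]mulr_natr mulVf // pnatr_eq0.
by rewrite -lt0n.
Qed.

Local Notation Prb := (Prb finish_mu).
Local Notation Omega := {ffun V -> C}.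

(** Live pairs suffice: under an outcome of positive weight, an edge that becomes monochromatic in
    [c] was live for [c]. *)
Definition mono_ev (j : C * {set V}) (w : Omega) :=
  (j.2 \in E) && live phi L j.2 j.1 &&
  [forall u, ((u \in j.2) && open u) ==> (w u == j.1)].

Definition mono_dom (j : C * {set V}) (u : V) :=
  [&& (j.2 \in E) && live phi L j.2 j.1, u \in j.2 & open u].

Lemma dep_mono j : depends_on (mono_dom j) (mono_ev j).
Proof.
move=> w w' h; rewrite /mono_ev; case: (boolP ((j.2 \in E) && live phi L j.2 j.1)) => //= jl.
apply: eq_forallb => u; case: (boolP ((u \in j.2) && open u)) => //= ju.
by rewrite h // /mono_dom jl.
Qed.

Lemma Prb_mono j u : mono_dom j u ->
  Prb (mono_ev j) = n%:R^-1 * n%:R^-1 ^+ #|others phi j.2 u|.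
Proof.
case: j => c e /and3P[/= jl ue pu].
have -> : Prb (mono_ev (c, e)) =
    Prb (fun w => [forall u, ((u \in e) && open u) ==> (w u == c)]).
  by apply: eq_Prb => w; rewrite /mono_ev /= jl.
rewrite (Prb_forall finish_mu_sum1 (S := fun u => pred1 u)); first last.
- by move=> x y i _ _ /eqP -> /eqP.
- by move=> x _ w w' h; rewrite h //=.
rewrite (eq_bigr (fun=> n%:R^-1)) => [|x /andP[xe /eqP px]]; last first.
  have := Exp_coord finish_mu_sum1 x (fun a : C => (a == c)%:R).
  rewrite /Prb => ->; rewrite (bigD1 c) //= eqxx mulr1 big1 ?addr0.
    rewrite /finish_mu px; case/andP: jl => _ /forall_inP/(_ _ xe).
    by rewrite px /= => ->.
  by move=> a /negPf ->; rewrite mulr0.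
rewrite prodr_const -exprS; congr (_ ^+ _).
rewrite (cardD1 u) unfold_in ue pu /= add1n; congr _.+1.
by apply: eq_card => x; rewrite !inE; case: (x == u); rewrite /= ?andbF ?andbT.
Qed.

(** The factor [n%:R^-1] contributed by [u] itself cancels the sum over the [n] colours of its
    list. *)
Lemma Prb_mono_sum u : open u ->
  \sum_(j | mono_dom j u) Prb (mono_ev j) <=
  \sum_(1 <= i < m.+1) Dg i * n%:R^-1 ^+ i.
Proof.
move=> pu.
rewrite (eq_bigr _ (fun j ju => Prb_mono ju)).
rewrite (eq_bigl (fun j => (j.1 \in L u) && (j.2 \in live_at E phi L u j.1))); last first.
  move=> [c e] /=; rewrite /mono_dom inE /= pu andbT.
  apply/idP/idP => [/andP[/andP[eE le] ue]|/and4P[_ -> -> ->]//].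
  rewrite eE le ue !andbT; move: (forall_inP le u ue).
  by rewrite (eqP pu).
rewrite -(pair_big_dep (mem (L u)) (fun c e => e \in live_at E phi L u c)
  (fun c e => n%:R^-1 * n%:R^-1 ^+ #|others phi e u|)) /=.
apply: (@le_trans _ _ (\sum_(c in L u) n%:R^-1 * \sum_(1 <= i < m.+1) Dg i * n%:R^-1 ^+ i)).
  apply: ler_sum => c cL; rewrite -mulr_sumr ler_wpM2l ?invr_ge0 //.
  apply: (sum_live_at unifE two_open degD (f := fun i => n%:R^-1 ^+ i)) => //.
rewrite sumr_const (cardL (eqP pu)) -[leLHS]mulr_natl mulrA mulfV ?mul1r //.
by rewrite pnatr_eq0 -lt0n.
Qed.

Lemma finish_colouring : exists Phi : V -> C,
  [/\ forall v c, phi v = Some c -> Phi v = c,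
      forall v, phi v = None -> Phi v \in L v &
      forall e c, e \in E -> exists2 u, u \in e & Phi u != c].
Proof.
have sum0 : 0 <= \sum_(1 <= i < m.+1) Dg i * n%:R^-1 ^+ i.
  by apply: sumr_ge0 => i _; rewrite mulr_ge0 // exprn_ge0 // invr_ge0.
have [w w0 wB] : exists2 w, 0 < weight finish_mu w & forall j, ~~ mono_ev j w.
  have nbr j : \sum_(j' | [exists u, mono_dom j u && mono_dom j' u]) Prb (mono_ev j') <= 4^-1.
    apply: (@le_trans _ _ (\sum_(u | mono_dom j u) \sum_(j' | mono_dom j' u) Prb (mono_ev j'))).
      rewrite [leRHS](exchange_big_dep xpredT) //= [leLHS]big_mkcond /=; apply: ler_sum => j' _.
      case: existsP => [[u /andP[ju j'u]]|_].
        rewrite (bigD1 u) ?ju //= lerDl sumr_ge0 // => *.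
        by apply: Prb_ge0; apply: finish_mu_ge0.
      by rewrite sumr_ge0 // => *; apply: Prb_ge0; apply: finish_mu_ge0.
    case: (boolP [exists u, mono_dom j u]) => [/existsP[u0 ju0]|jN]; last first.
      rewrite big_pred0 // => u; apply/negP => ju; case/negP: jN; apply/existsP.
      by exists u.
    have eE : j.2 \in E by case/and3P: ju0 => /andP[].
    apply: le_trans small; rewrite -[X in X%:R * _](unifE eE).
    apply: (@le_trans _ _ (\sum_(u | mono_dom j u) \sum_(1 <= i < m.+1) Dg i * n%:R^-1 ^+ i)).
      by apply: ler_sum => u /and3P[_ _ pu]; apply: Prb_mono_sum.
    rewrite sumr_const -[leLHS]mulr_natl ler_wpM2r // ler_nat; apply: subset_leq_card.
    by apply/subsetP => u /and3P[].
  apply: (local_lemma finish_mu_ge0 finish_mu_sum1 dep_mono) => // j.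
  case: (boolP [exists u, mono_dom j u]) => [/existsP[u ju]|jN].
    apply: le_trans (nbr j); rewrite (bigD1 j) /=; last by apply/existsP; exists u; rewrite ju.
    by rewrite lerDl sumr_ge0 // => *; apply: Prb_ge0; apply: finish_mu_ge0.
  have -> : Prb (mono_ev j) = Prb (fun=> false); last by rewrite [Prb _](Exp_cst finish_mu_sum1) invr_ge0.
  apply: eq_Prb => w.
  apply/negP => /andP[/andP[jE jl] _]; case/negP: jN.
  have := two_open jE jl; case/ltnW/card_gt0P => u; rewrite inE => /andP[ue pu].
  by apply/existsP; exists u; rewrite /mono_dom jE jl ue pu.
(* A point of positive weight has positive factors, so it extends [phi] and respects the lists. *)
have wv v : 0 < finish_mu v (w v).
  rewrite lt_def finish_mu_ge0 andbT; apply: contraTneq w0 => v0.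
  by rewrite /weight (bigD1 v) //= v0 mul0r ltxx.
have wS v c : phi v = Some c -> w v = c.
  by have := wv v; rewrite /finish_mu => + pv; rewrite pv; case: eqP => // _; rewrite ltxx.
have wN v : phi v = None -> w v \in L v.
  by have := wv v; rewrite /finish_mu => + pv; rewrite pv; case: ifP => // _; rewrite ltxx.
exists w; split=> [||e c eE]; [exact: wS | exact: wN |].
apply/exists_inP; apply: contraT; rewrite negb_exists_in => /forall_inP h.
have hc u : u \in e -> w u = c by move=> /h; rewrite negbK => /eqP.
have le : live phi L e c.
  apply/forall_inP => u ue; case pu: (phi u) => [c'|] /=.
    by rewrite -(wS _ _ pu) hc ?eqxx.
  by rewrite -(hc u ue) wN.
case/negP: (wB (c, e)); rewrite /mono_ev /= eE le; apply/forallP => u.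
by apply/implyP => /andP[/hc -> _].
Qed.

End Finish.

(** * Numerical evolution *)

Lemma bin_transpose m i j : (i <= j <= m)%N ->
  ('C(m, j) * 'C(j, i) = 'C(m, i) * 'C(m - i, j - i))%N.
Proof.
move=> /andP[ij jm].
have im := leq_trans ij jm.
have pos : (0 < i`! * (j - i)`! * (m - j)`!)%N by rewrite !muln_gt0 !fact_gt0.
apply/eqP; rewrite -(eqn_pmul2r pos); apply/eqP.
have e1 := bin_fact jm; have e2 := bin_fact ij; have e3 := bin_fact im.
have e4 : ('C(m - i, j - i) * ((j - i)`! * (m - j)`!) = (m - i)`!)%N.
  by rewrite -(bin_fact (leq_sub2r i jm)); congr (_ * (_ * _`!))%N; lia.
transitivity m`!.
  by rewrite -e1 -e2; ring.
by rewrite -e3 -e4; ring.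
Qed.

Section Profile.
Variables (R : realType) (m : nat).
Implicit Types (D N b x u v A : R).

Definition profile D A x (i : nat) : R := D * 'C(m, i)%:R * A ^+ i * x ^+ (m - i).

Lemma profile_ge0 D A x i : 0 <= D -> 0 <= A -> 0 <= x -> 0 <= profile D A x i.
Proof. by move=> D0 A0 x0; rewrite /profile !mulr_ge0 ?exprn_ge0. Qed.

(** The binomial theorem without its term [i = 0]. With [p] the pick probability this is the union
    bound for deletion. *)
Lemma sum_profile D A x p :
  \sum_(1 <= i < m.+1) profile D A x i * p ^+ i = D * ((x + A * p) ^+ m - x ^+ m).
Proof.
rewrite exprDn big_ord_recl /= subn0 expr0 mulr1 bin0 mulr1n addrC addKr mulr_sumr.
rewrite big_add1 /= big_mkord; apply: eq_bigr => i _.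
rewrite /profile /= /bump /= add1n exprMn -mulr_natr; ring.
Qed.

(** Binomial thinning, that is, regrouping [D * (A * u + (x + A * v)) ^+ m]. The absent term [j = 0]
    would not contribute because [i > 0]. *)
Lemma profile_thin D A x u v i : (0 < i <= m)%N ->
  \sum_(1 <= j < m.+1) profile D A x j * ('C(j, i)%:R * u ^+ i * v ^+ (j - i)) =
  profile D (A * u) (x + A * v) i.
Proof.
move=> /andP[i0 im].
rewrite (big_cat_nat (n := i)) //=; last exact: leqW.
rewrite [X in X + _]big_nat_cond big1 ?add0r => [|j]; last first.
  by rewrite andbT => /andP[_ ji]; rewrite bin_small // mul0r mul0r mulr0.
rewrite -{1}[i]add0n big_addn big_mkord subSn // {2}/profile exprDn mulr_sumr.
apply: eq_bigr => j _.
have jm : (j <= m - i)%N by rewrite -ltnS.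
have ijm : (i <= j + i <= m)%N by rewrite leq_addl /=; lia.
have := congr1 (fun n => n%:R : R) (bin_transpose ijm).
rewrite addnK !natrM /profile -[_ *+ 'C(m - i, j)]mulr_natr => h.
have -> : (m - (j + i) = m - i - j)%N by lia.
rewrite !exprMn exprD.
transitivity (D * ('C(m, j + i)%:R * 'C(j + i, i)%:R) * A ^+ j * A ^+ i *
   x ^+ (m - i - j) * u ^+ i * v ^+ j); first by ring.
by rewrite h; ring.
Qed.

(** As [i > 0], a factor [c >= 1] is absorbed by [A] alone. In this way the Chernoff slack is
    charged to [step_b]. *)
Lemma profile_le D A x A' x' c i : (0 < i)%N -> 0 <= D -> 0 <= A -> 0 <= x -> 1 <= c ->
  c * A <= A' -> x <= x' -> c * profile D A x i <= profile D A' x' i.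
Proof.
move=> i0 D0 A0 x0 c1 AA xx; have c0 := le_trans ler01 c1.
have cA : c * A ^+ i <= A' ^+ i.
  apply: (@le_trans _ _ ((c * A) ^+ i)); last by rewrite lerXn2r ?nnegrE ?mulr_ge0 // (le_trans _ AA) ?mulr_ge0.
  by rewrite exprMn ler_wpM2r ?exprn_ge0 // ler_eXnr.
rewrite /profile; have -> : c * (D * 'C(m, i)%:R * A ^+ i * x ^+ (m - i)) =
  D * 'C(m, i)%:R * (c * A ^+ i) * x ^+ (m - i) by ring.
apply: ler_pM; rewrite ?mulr_ge0 ?exprn_ge0 //.
  by rewrite ler_wpM2l ?mulr_ge0.
by rewrite lerXn2r ?nnegrE ?(le_trans x0).
Qed.

End Profile.

Lemma natceil_exists (R : realType) (N : R) : 0 <= N ->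
  exists n : nat, [/\ N <= n%:R, n%:R <= N + 1 & forall j : nat, N <= j%:R -> (n <= j)%N].
Proof.
move=> N0; have /andP[t1 t2] := truncn_itv N0; set t := Num.truncn N in t1 t2.
have [tN|tN] := eqVneq t%:R N.
  by exists t; rewrite tN lexx lerDl ler01; split=> // j; rewrite -tN ler_nat.
exists t.+1; rewrite -natr1 lerD2r t1 natr1 (ltW t2); split=> // j Nj.
by rewrite -(ltr_nat R) (lt_le_trans _ Nj) // lt_neqAle tN.
Qed.

(** Used with [a = al ^+ 2] and [u = al * q]: [1 + 3 * a] is the Chernoff slack, [1 - u + 3 * a]
    bounds the probability of staying open, [1 - 2 * a] is the loss in [step_N], and [1 - p] is the
    denominator of [qplus]. The [12 * a] of [step_b] pays for all of them. *)
Lemma decay_absorb (R : realType) (u a p : R) : 0 <= u <= 50^-1 -> 0 <= a <= 2500^-1 ->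
  0 <= p <= a ->
  (1 + 3 * a) * (1 - u + 3 * a) <= (1 - u + 12 * a) * (1 - 2 * a) * (1 - p).
Proof.
move=> /andP[u0 u1] /andP[a0 a1] /andP[p0 p1].
have aa : a * a <= a * 2500^-1 by rewrite ler_wpM2l.
have au : 0 <= a * u by rewrite mulr_ge0.
apply: (@le_trans _ _ (1 - u + 7 * a)); first lra.
apply: (@le_trans _ _ ((1 - u + 12 * a) * (1 - 3 * a))); first lra.
rewrite -mulrA; apply: ler_wpM2l; first lra.
have : 0 <= a * p by rewrite mulr_ge0.
lra.
Qed.

(** Giving up [al * N + 1] colours costs only a second order term in the exponent. *)
Lemma decay_exponent (R : realType) (N al p q : R) : 0 < al -> p * N = al -> p <= al ^+ 2 ->
  0 < p -> 0 <= q <= 1 -> al * q - 2 * al ^+ 2 <= (N - (al * N + 1)) * (p * q).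
Proof.
move=> a0 pN pal p0 /andP[q0 q1].
have -> : (N - (al * N + 1)) * (p * q) = (p * N) * q - al * (p * N) * q - p * q by ring.
rewrite pN.
have : al * al * q <= al ^+ 2 by rewrite -expr2 ler_piMr // exprn_ge0 // ltW.
have : p * q <= p by rewrite ler_piMr // ltW.
lra.
Qed.

(** * One round in terms of the numerical parameters *)

Section NibbleStep.
Variables (R : realType) (V C : finType) (E : {set {set V}}) (m : nat).
Hypothesis uE : uncrowded E.
Hypothesis unifE : uniform E m.+1.
Hypothesis m_gt0 : (0 < m)%N.
Variables (D N b x al : R).
Hypothesis al01 : 0 < al <= 50^-1.
Hypothesis D_gt0 : 0 < D.
Hypothesis b_gt0 : 0 < b.
Hypothesis x_ge0 : 0 <= x.
Hypothesis N_ge : 5 <= N * al.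

(* The al ^+ 2 terms in step_b and step_x absorb all second order errors. *)
Definition step_q : R := 1 - D * ((x + b * al) ^+ m - x ^+ m).
Definition step_N : R := (1 - 2 * al ^+ 2) * (step_q * N).
Definition step_b : R := b * (1 - al * step_q + 12 * al ^+ 2).
Definition step_x : R := x + al * b * step_q + al ^+ 2 * b.

Hypothesis q_ge : 2^-1 <= step_q.

Let al0 : 0 < al. Proof. by case/andP: al01. Qed.
Let al1 : al <= 50^-1. Proof. by case/andP: al01. Qed.

Lemma N_ge2 : 2 <= N.
Proof. by have := N_ge; have := al0; have := al1; nra. Qed.

Lemma N_gt0 : 0 < N.
Proof. by apply: lt_le_trans N_ge2; rewrite ltr0n. Qed.

Lemma step_q_lt1 : step_q < 1.
Proof.
rewrite /step_q ltrBlDr ltrDl mulr_gt0 // subr_gt0 ltrXn2r ?nnegrE -?lt0n //; first by rewrite ltrDl mulr_gt0.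
Qed.

Lemma stay_bound_le (n Mz : nat) : N <= n%:R -> Mz%:R <= al * N ->
  (1 + 3 * al ^+ 2) * (b * N * (qplus (al / N) step_q * stay_bound n (al / N) step_q Mz))
   <= step_b * step_N.
Proof.
move=> Nn MzN; have [a0 a1] : 0 < al /\ al <= 50^-1 by [].
have N0 := N_gt0.
have pN : al / N * N = al by rewrite divfK // gt_eqF.
have pal : al / N <= al ^+ 2.
  rewrite ler_pdivrMr // expr2 -mulrA ler_peMr ?(ltW al0) //.
  by rewrite mulrC; apply: le_trans N_ge; rewrite ler1n.
have : 0 < al / N by rewrite divr_gt0.
rewrite /step_b /step_N /qplus; move: step_q step_q_lt1 q_ge => q q1 qh.
have q0 : 0 <= q by apply: le_trans qh; rewrite invr_ge0.
move: (al / N) pN pal => p pN pal p0.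
have a20 : 0 < al ^+ 2 by rewrite exprn_gt0.
have a2 : al ^+ 2 <= 2500^-1.
  apply: (@le_trans _ _ (50^-1 ^+ 2)); first by rewrite lerXn2r ?nnegrE ?invr_ge0 // ltW.
  by rewrite expr2; lra.
have p1 : p < 1 by apply: le_lt_trans pal _; apply: le_lt_trans a2 _; lra.
have u0 : 0 <= al * q by rewrite mulr_ge0 // ltW.
have u1 : al * q <= 50^-1.
  by apply: le_trans a1; rewrite ler_piMr // ltW.
have s_le : stay_bound n p q Mz <= 1 - al * q + 3 * al ^+ 2.
  set t := al * q - 2 * al ^+ 2.
  have t0 : 0 <= t.
    rewrite subr_ge0 expr2 mulrCA ler_wpM2l ?(ltW a0) //.
    lra.
  have pq1 : 0 <= 1 - p * q by rewrite subr_ge0 mulr_ile1 // ltW.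
  apply: (@le_trans _ _ (expR (- t))).
    apply: (@le_trans _ _ (expR (- (p * q)) ^+ (n - Mz.+1))).
      by rewrite lerXn2r ?nnegrE ?expR_ge0 // expR_ge1Dx.
    rewrite -expRM_natl ler_expR mulrN lerN2.
    apply: le_trans (decay_exponent a0 pN pal p0 _) _; first by rewrite q0 ltW.
    rewrite ler_wpM2r ?mulr_ge0 // ?(ltW p0) //.
    apply: (@le_trans _ _ (n%:R - Mz.+1%:R)); last first.
      by rewrite lerBlDr -natrD ler_nat addnC -leq_subLR.
    by rewrite lerB // -natr1 lerD2r.
  apply: le_trans (expRN_le t0) _.
  have : t ^+ 2 <= al ^+ 2.
    rewrite lerXn2r ?nnegrE ?(ltW al0) //.
    have : al * q <= al by rewrite ler_piMr // ltW.
    by rewrite /t; lra.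
  by rewrite /t; lra.
move: (stay_bound n p q Mz) s_le => s s_le.
have -> : (1 + 3 * al ^+ 2) * (b * N * (q / (1 - p) * s)) =
   (b * N * q) * ((1 + 3 * al ^+ 2) * s / (1 - p)) by ring.
have -> : b * (1 - al * q + 12 * al ^+ 2) * ((1 - 2 * al ^+ 2) * (q * N)) =
   (b * N * q) * ((1 - al * q + 12 * al ^+ 2) * (1 - 2 * al ^+ 2)) by ring.
apply: ler_wpM2l; first by rewrite !mulr_ge0 // ltW.
rewrite ler_pdivrMr ?subr_gt0 //.
apply: le_trans (decay_absorb _ _ _).
- by apply: ler_wpM2l s_le; rewrite addr_ge0 // mulr_ge0 // ltW.
- by rewrite u0.
- by rewrite (ltW a20).
- by rewrite (ltW p0).
Qed.

Variables (W B : R).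
Hypothesis W_q : W <= al ^+ 4 * (step_q * N).
Hypothesis W_N : W <= N * al / 10.
Hypothesis W_D : forall i, (0 < i <= m)%N ->
  W <= al ^+ 4 * (profile m D (step_b * step_N) step_x i / 2).
Hypothesis B_ge : \sum_(1 <= i < m.+1) profile m D (b * N) x i <= B.
Hypothesis lll : (1 + (N + 1) * (m.+1%:R * B)) ^+ 4 *
  ((2 + (N + 1) * m%:R) * expR (- W)) <= 4^-1.

(** [W] bounds all Chernoff exponents from below, which carry [al ^+ 4] because the relative
    deviation is [al ^+ 2]. Up to [al * N] picks are tolerated at a vertex: far more than the
    expected number, about [al], yet only a fraction [al] of the list. *)
Lemma nibble_step (L0 : V -> {set C}) : reduced E L0 m N (profile m D (b * N) x) ->
  reduced E L0 m step_N (profile m D (step_b * step_N) step_x).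
Proof.
have [a0 a1] : 0 < al /\ al <= 50^-1 by [].
have N250 := N_ge2; have N0 := N_gt0.
have [n [Nn nN nmin]] := natceil_exists (ltW N0).
move=> /(reduced_trim nmin) [phi [L [h1 h2 h3 h4 h5]]].
have q1 := step_q_lt1; have qh := q_ge.
have a2 : al ^+ 2 <= al / 50 by rewrite expr2 ler_wpM2l // ltW.
have a20 : 0 < al ^+ 2 by rewrite exprn_gt0.
have p0 : 0 < al / N by rewrite divr_gt0.
have palN : al / N * N = al by rewrite divfK // gt_eqF.
have pal2 : 2 * (al / N) <= al by nra.
have p1 : al / N < 1 by have := al1; lra.
have /andP[Mz1 Mz2] : (Num.truncn (al * N))%:R <= al * N < (Num.truncn (al * N)).+1%:R.
  by apply: truncn_itv; rewrite mulr_ge0 // ltW.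
set Mz := Num.truncn (al * N) in Mz1 Mz2.
have D0 := ltW D_gt0; have b0 := ltW b_gt0.
have prof0 i : 0 <= profile m D (b * N) x i.
  by rewrite profile_ge0 // mulr_ge0 // ltW.
have B0 : 0 <= B by apply: le_trans B_ge; apply: sumr_ge0.
have pq : al / N * (step_q / (1 - al / N)) * (b * N) <= al * b * step_q + al ^+ 2 * b.
  have -> : al / N * (step_q / (1 - al / N)) * (b * N) =
     (al / N * N) * b * (step_q / (1 - al / N)) by ring.
  rewrite palN; have : step_q / (1 - al / N) <= step_q + al.
    rewrite ler_pdivrMr ?subr_gt0 //; nra.
  have : 0 < al * b by rewrite mulr_gt0.
  nra.
have c0 : 0 < 1 + 3 * al ^+ 2 by lra.
have sN0 : 0 <= step_N by rewrite /step_N !mulr_ge0 //; lra.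
have sb0 : 0 <= step_b by rewrite /step_b mulr_ge0 //; nra.
have sx0 : 0 <= step_x.
  by rewrite /step_x !addr_ge0 // !mulr_ge0 // ?ltW //; lra.
(* The mean is taken to be the new bound divided by the Chernoff factor [1 + 3 * al ^+ 2], which is
   below 2. *)
have mono i : (0 < i <= m)%N -> W <= (al ^+ 2) ^+ 2 *
    (profile m D (step_b * step_N) step_x i / (1 + 3 * al ^+ 2)).
  move=> im; apply: le_trans (W_D im) _.
  rewrite -exprM; apply: ler_wpM2l; first by rewrite exprn_ge0 // ltW.
  apply: ler_wpM2l; first exact: profile_ge0 D0 (mulr_ge0 sb0 sN0) sx0.
  by rewrite lef_pV2 ?posrE //; lra.
apply: (@step_reduced R V C E m uE unifE phi L n (profile m D (b * N) x) h3 h4 h5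
  (al / N) step_q _ _ _ Mz (al ^+ 2)
  (fun i => profile m D (step_b * step_N) step_x i / (1 + 3 * al ^+ 2))
  (profile m D (step_b * step_N) step_x) _ _ _
  (1 + (N + 1) * (m.+1%:R * B)) _ step_N _ _
  ((2 + (N + 1) * m%:R) * expR (- W)) _ lll L0 h1 h2).
- by rewrite p0 p1.
- by rewrite q1 andbT; lra.
- rewrite sum_profile (_ : b * N * (al / N) = b * al); last by rewrite mulrAC -mulrA palN; ring.
  by rewrite /step_q; lra.
- by apply/andP; split; lra.
- move=> i im; rewrite profile_thin // ler_pdivlMr // mulrC.
  case/andP: (im) => i0 _.
  have s0 : 0 <= stay_bound n (al / N) step_q Mz.
    by rewrite exprn_ge0 // subr_ge0; nra.
  have qp0 : 0 <= qplus (al / N) step_q by rewrite /qplus; apply: divr_ge0; lra.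
  apply: profile_le => //.
  + by apply: mulr_ge0; apply: mulr_ge0 => //; apply: ltW.
  + apply: addr_ge0 => //; apply: mulr_ge0; apply: mulr_ge0 => //; exact: ltW.
  + lra.
  + exact: stay_bound_le.
  + by rewrite /step_x -addrA lerD2l [leLHS]mulrC.
- by move=> i _; rewrite mulrC divfK // gt_eqF.
- rewrite lerD2l; apply: ler_pM => //; first by rewrite mulr_ge0 // sumr_ge0.
  by rewrite ler_wpM2l.
- by rewrite /step_N ler_wpM2l //; [nra | rewrite ler_wpM2l //; lra].
- have : al / N * n%:R <= al / N * (N + 1) by rewrite ler_wpM2l // ltW.
  have := N_ge; rewrite mulrC mulrDr palN; nra.
- have e1 : expR (- ((al ^+ 2) ^+ 2 * (step_q * n%:R))) <= expR (- W).
    rewrite ler_expR lerN2; apply: le_trans W_q _; rewrite -exprM.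
    by rewrite ler_wpM2l ?exprn_ge0 ?(ltW al0) // ler_wpM2l //; lra.
  have e2 : expR (- (Mz.+1%:R / 10)) <= expR (- W).
    by rewrite ler_expR lerN2; have := W_N; lra.
  have e3 : n%:R * (\sum_(1 <= i < m.+1) expR (- ((al ^+ 2) ^+ 2 *
     (profile m D (step_b * step_N) step_x i / (1 + 3 * al ^+ 2))))) <=
     (N + 1) * (m%:R * expR (- W)).
    apply: ler_pM => //; first by apply: sumr_ge0 => i _; apply: expR_ge0.
    apply: (@le_trans _ _ (\sum_(1 <= i < m.+1) expR (- W))).
      rewrite big_nat_cond [leRHS]big_nat_cond; apply: ler_sum => i.
      by rewrite andbT ltnS => im; rewrite ler_expR lerN2 mono.
    by rewrite sumr_const_nat subn1 /= mulr_natl.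
  lra.
Qed.

End NibbleStep.

(** * Elementary inequalities for powers *)

Section PowerInequalities.
Variable R : realType.
Implicit Types (x y h q t : R).

Lemma bernoulli_ineq t n : 0 <= t <= 1 -> 1 - n%:R * (1 - t) <= t ^+ n.
Proof.
move=> /andP[t0 t1]; elim: n => [|n IH]; first by rewrite mul0r subr0 expr0.
rewrite exprS; apply: (@le_trans _ _ (t * (1 - n%:R * (1 - t)))); last by rewrite ler_wpM2l.
have : 0 <= n%:R * ((1 - t) * (1 - t)) by rewrite !mulr_ge0 // subr_ge0.
rewrite -natr1; lra.
Qed.

Lemma expr_sub_le x y m : 0 <= x <= y -> y <= 2 -> y ^+ m - x ^+ m <= (y - x) * (m%:R * 2 ^+ m).
Proof.
move=> /andP[x0 xy] y2; have y0 := le_trans x0 xy.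
rewrite subrXX ler_wpM2l ?subr_ge0 //.
apply: (@le_trans _ _ (\sum_(i < m) 2 ^+ m)); last by rewrite sumr_const card_ord mulr_natl.
apply: ler_sum => i _; have im : (m.-1 - i + i <= m)%N.
  by rewrite subnK ?leq_pred //; case: i => i /=; case: (m).
apply: (@le_trans _ _ (2 ^+ (m.-1 - i + i))); last by rewrite ler_eXn2l ?ltr1n.
rewrite exprD; apply: ler_pM; rewrite ?exprn_ge0 //.
  by rewrite lerXn2r ?nnegrE.
by rewrite lerXn2r ?nnegrE // (le_trans xy).
Qed.

(** The deletion probability is computed with the increment [h = b * al], whereas [x] moves only by
    about [h * q]; this bounds the discrepancy. Termwise it is [q * (x + h) <= x + h * q]. *)
Lemma expr_sub_scale x h q m : 0 <= x -> 0 <= h -> 0 <= q <= 1 -> (0 < m)%N ->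
  q ^+ m * ((x + h) ^+ m - x ^+ m) <= (x + h * q) ^+ m - x ^+ m.
Proof.
move=> x0 h0 /andP[q0 q1] m0; rewrite !subrXX.
have -> : x + h - x = h by ring.
have -> : x + h * q - x = h * q by ring.
rewrite mulrCA -mulrA ler_wpM2l // -{1}(prednK m0) exprS -mulrA ler_wpM2l // mulr_sumr.
apply: ler_sum => i _; rewrite mulrA ler_wpM2r ?exprn_ge0 //.
apply: (@le_trans _ _ ((q * (x + h)) ^+ (m.-1 - i))).
  rewrite exprMn ler_wpM2r ?exprn_ge0 ?addr_ge0 //.
  by rewrite ler_wiXn2l // leq_subr.
rewrite lerXn2r ?nnegrE ?mulr_ge0 ?addr_ge0 ?mulr_ge0 //.
have : q * x <= x by rewrite ler_piMl.
lra.
Qed.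

End PowerInequalities.

(** * Iterating the round *)

Section Iteration.
Variables (R : realType) (m : nat) (La D N0 eta : R).
Hypothesis m_gt0 : (0 < m)%N.
Hypothesis La_ge : 100 <= La.
Hypothesis D_ge1 : 1 <= D.
Hypothesis D_le : D <= La.
Hypothesis eta01 : 0 < eta <= 1.
Hypothesis La_big : m.+1%:R * (m%:R * 2 ^+ m) * 60 <= eta * La.
Hypothesis DN0 : D * N0 ^+ m <= expR La.
Hypothesis N0_ge1 : 1 <= N0.
Hypothesis N0_big : La ^+ (20 + 6 * m) <= N0 * expR (- ((1 + eta) ^+ 2 * D) - 1).

Let l : R := La^-1.
(** The value of [al]. The second order losses in [N] add up to at most [16 * act * La ^+ 2] in the
    exponent, so [act] has to be well below [La ^- 2]. *)
Definition act : R := La^-1 ^+ 3.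

Let La_gt0 : 0 < La. Proof. by apply: lt_le_trans La_ge; lra. Qed.
Let l_gt0 : 0 < l. Proof. by rewrite invr_gt0. Qed.
Let Lal : La * l = 1. Proof. by rewrite mulfV // gt_eqF. Qed.
Let l_le : l <= 100^-1.
Proof. by rewrite lef_pV2 ?posrE //; lra. Qed.
Let l_le1 : l <= 1. Proof. by apply: le_trans l_le _; lra. Qed.
Let act_gt0 : 0 < act. Proof. by rewrite exprn_gt0. Qed.
Let act_le : act <= l / 100.
Proof.
rewrite /act -/l exprS ler_wpM2l ?(ltW l_gt0) //.
by apply: le_trans l_le; rewrite expr2 ler_piMr // ltW.
Qed.

(** Errors are charged to the decrease of [b], at least [b * act / 4] per round. There [x + b] grows
    by [13 * act ^+ 2 * b], and [52 = 4 * 13]. The lists lose an extra factor at worst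
    [expR (- (4 * act ^+ 2))]; as [1 <= La ^+ 2 * b], that exponent is at most [16 * act * La ^+ 2]
    times the decrease. *)
Definition invariant (N b x : R) :=
  [/\ 0 < b <= 1, 0 <= x, x + b <= 1 + 52 * act * (1 - b),
      N0 * expR (- ((1 + eta) * (D * x ^+ m)) - 16 * act * La ^+ 2 * (1 - b)) <= N &
      N <= N0].

Let c0 : R := m%:R * 2 ^+ m.
Let c0_ge : 2 <= c0.
Proof.
apply: (@le_trans _ _ (1 * 2 ^+ 1)); first by rewrite mul1r expr1.
by apply: ler_pM; rewrite ?ler1n // ler_eXn2l ?ltr1n.
Qed.
Let c0_le : m.+1%:R * c0 * 60 <= eta * La. Proof. exact: La_big. Qed.

Lemma invariant_le2 N b x : invariant N b x -> x + b <= 2 /\ x + b <= 1 + 52 * act.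
Proof.
case=> /andP[b0 b1] x0 h _ _; have := act_le; have := l_le; have := act_gt0.
have : 0 <= act * b by rewrite mulr_ge0 // ltW.
by split; lra.
Qed.

Lemma invariant_xm N b x : invariant N b x -> x ^+ m <= 1 + eta.
Proof.
move=> inv; have [y2 y1] := invariant_le2 inv; case: inv => /andP[b0 _] x0 _ _ _.
have [x1|x1] := leP x 1.
  apply: (@le_trans _ _ 1); first by rewrite exprn_ile1.
  by rewrite lerDl; case/andP: eta01 => /ltW.
have := @expr_sub_le R 1 x m _ _; rewrite expr1n ler01 (ltW x1) => /(_ isT).
move=> /(_ (le_trans _ y2)) h.
have xy : x <= x + b by rewrite lerDl ltW.
have {}h := h xy.
have cc : 0 <= c0 by apply: le_trans c0_ge; rewrite ler0n.
have x52 : x - 1 <= 52 * act by rewrite lerBlDr addrC; apply: le_trans xy y1.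
have := ler_wpM2r cc x52; have := ler_wpM2r cc act_le.
have lc : l * c0 <= eta.
  apply: (@le_trans _ _ (l * (eta * La))); last by rewrite mulrCA (mulrC l) Lal mulr1.
  rewrite ler_wpM2l ?(ltW l_gt0) //.
  have : c0 <= m.+1%:R * c0 by rewrite ler_peMl ?ler1n //; lra.
  have := c0_le; lra.
move: h; rewrite -/c0; case/andP: eta01; lra.
Qed.

(** One factor [1 + eta] comes from the invariant, the other from [x ^+ m <= 1 + eta]; the second
    order losses total at most [16 / 100], covered by the [- 1] in [N0_big]. *)
Lemma invariant_N N b x : invariant N b x -> La ^+ (20 + 6 * m) <= N.
Proof.
move=> inv; have xm := invariant_xm inv; case: inv => /andP[b0 b1] x0 _ h _.
apply: le_trans N0_big _; apply: le_trans h; rewrite ler_wpM2l ?(le_trans ler01) // ler_expR.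
have e0 : 0 < eta by case/andP: eta01.
have h1 : (1 + eta) * (D * x ^+ m) <= (1 + eta) ^+ 2 * D.
  have h0 : D * x ^+ m <= D * (1 + eta) by apply: ler_wpM2l => //; apply: le_trans D_ge1.
  by rewrite expr2 -mulrA [X in _ <= _ * X]mulrC ler_wpM2l //; lra.
have h2 : act * La ^+ 2 <= 100^-1.
  rewrite /act -/l (_ : l ^+ 3 * La ^+ 2 = l * (La * l) ^+ 2); last by ring.
  by rewrite Lal expr1n mulr1.
have h3 : 0 <= act * La ^+ 2 by rewrite mulr_ge0 ?exprn_ge0 // ltW.
have : act * La ^+ 2 * (1 - b) <= act * La ^+ 2 by rewrite ler_piMr //; lra.
lra.
Qed.

Lemma q_lower N b x : invariant N b x -> step_q m D b x act < 1 ->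
  1 - step_q m D b x act <= eta / (60 * m.+1%:R).
Proof.
move=> inv _; have [y2 y1] := invariant_le2 inv; case: inv => /andP[b0 b1] x0 _ _ _.
rewrite /step_q opprB addrC subrK.
have ba : b * act <= b by rewrite ler_piMr ?(ltW b0) //; have := act_le; have := l_le; lra.
have ba0 : 0 <= b * act by rewrite mulr_ge0 // ltW.
have h : (x + b * act) ^+ m - x ^+ m <= b * act * c0.
  have := @expr_sub_le R x (x + b * act) m; rewrite x0 lerDl ba0 => /(_ isT) h.
  apply: le_trans (h _) _; first lra.
  by rewrite addrAC subrr add0r.
apply: (@le_trans _ _ (La * (b * act * c0))).
  apply: ler_pM => //; first exact: le_trans D_ge1.
  by rewrite subr_ge0 lerXn2r ?nnegrE ?addr_ge0 // lerDl.
rewrite ler_pdivlMr ?mulr_gt0 ?ltr0n //.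
apply: (@le_trans _ _ (La * (act * c0) * (60 * m.+1%:R))).
  rewrite ler_wpM2r ?mulr_ge0 // ler_wpM2l ?(ltW La_gt0) // -mulrA ler_piMl //.
  by rewrite mulr_ge0 ?(ltW act_gt0) //; have := c0_ge; lra.
have -> : La * (act * c0) * (60 * m.+1%:R) = (La * l) * l ^+ 2 * (m.+1%:R * c0 * 60).
  by rewrite /act -/l; ring.
rewrite Lal mul1r; apply: (@le_trans _ _ (l ^+ 2 * (eta * La))).
  by rewrite ler_wpM2l ?exprn_ge0 // ltW.
rewrite (_ : l ^+ 2 * (eta * La) = eta * (La * l) * l); last by ring.
by rewrite Lal mulr1 ler_piMr //; case/andP: eta01 => /ltW.
Qed.

Section OneStep.
Variables (N b x : R).
Hypothesis inv : invariant N b x.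
Hypothesis b_big : l ^+ 2 <= b.

Local Notation q := (step_q m D b x act).
Local Notation b' := (step_b m D b x act).
Local Notation x' := (step_x m D b x act).
Local Notation N' := (step_N m D N b x act).

Let b0 : 0 < b. Proof. by case: inv => /andP[]. Qed.
Let x0 : 0 <= x. Proof. by case: inv. Qed.

Lemma q_bounds : 2^-1 <= q /\ q < 1.
Proof.
have q1 : q < 1.
  have D0 : 0 < D by apply: lt_le_trans D_ge1.
  by apply: step_q_lt1 => //; rewrite act_gt0; have := act_le; have := l_le; lra.
split=> //; have := q_lower inv q1.
have : eta / (60 * m.+1%:R) <= 60^-1.
  rewrite ler_pdivrMr ?mulr_gt0 ?ltr0n // mulrA mulVf ?mul1r ?pnatr_eq0 //.
  by case/andP: eta01 => _ /le_trans; apply; rewrite ler1n.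
move=> h1 h2; have := le_trans h2 h1; rewrite lerBlDr; lra.
Qed.

Lemma q_power : 1 <= (1 + eta) * q ^+ m.+1.
Proof.
have [qh q1] := q_bounds; have /andP[e0 e1] := eta01.
have h := q_lower inv q1.
have h2 : 1 - m.+1%:R * (1 - q) <= q ^+ m.+1.
  by apply: bernoulli_ineq; rewrite (ltW q1) andbT; lra.
have h1 : m.+1%:R * (1 - q) <= eta / 60.
  have -> : eta / 60 = m.+1%:R * (eta / (60 * m.+1%:R)).
    rewrite invfM (_ : m.+1%:R * _ = eta / 60 * (m.+1%:R / m.+1%:R)); last by ring.
    by rewrite divff ?mulr1 // pnatr_eq0.
  by rewrite ler_wpM2l.
apply: (@le_trans _ _ ((1 + eta) * (1 - eta / 60))); first nra.
by rewrite ler_wpM2l //; lra.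
Qed.

Let T := (1 + eta) * (D * (x' ^+ m - x ^+ m)).

(** By [expr_sub_scale], [D * x ^+ m] grows by at least [q ^+ m * (1 - q)]. Hence [q * expR T] is at
    least [q + (1 + eta) * q ^+ m.+1 * (1 - q)], and the slack [eta] outweighs the power of [q] by
    [q_power]. *)
Lemma q_expR : 1 <= q * expR T.
Proof.
have [qh q1] := q_bounds; have /andP[e0 e1] := eta01.
have q0 : 0 < q by lra.
have D0 : 0 <= D by apply: le_trans D_ge1.
have h : q ^+ m * (1 - q) <= D * (x' ^+ m - x ^+ m).
  rewrite {2}/step_q opprB addrC subrK mulrCA ler_wpM2l //.
  apply: le_trans (expr_sub_scale x0 (mulr_ge0 (ltW b0) (ltW act_gt0)) _ m_gt0) _.
    by rewrite !ltW.
  rewrite lerD2r lerXn2r ?nnegrE //.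
  - by rewrite addr_ge0 // !mulr_ge0 // ltW.
  - by rewrite /step_x !addr_ge0 // !mulr_ge0 // ?exprn_ge0 // ltW.
  - by rewrite /step_x [b * act]mulrC -addrA lerD2l lerDl mulr_ge0 ?exprn_ge0 // ltW.
have h1 : 1 + (1 + eta) * (q ^+ m * (1 - q)) <= expR T.
  apply: le_trans (expR_ge1Dx _); rewrite lerD2l ler_wpM2l //; lra.
apply: (@le_trans _ _ (q * (1 + (1 + eta) * (q ^+ m * (1 - q))))); last by rewrite ler_wpM2l // ltW.
have -> : q * (1 + (1 + eta) * (q ^+ m * (1 - q))) = q + (1 + eta) * q ^+ m.+1 * (1 - q).
  by rewrite exprS; ring.
have : 1 * (1 - q) <= (1 + eta) * q ^+ m.+1 * (1 - q).
  by rewrite ler_wpM2r ?q_power // subr_ge0 ltW.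
lra.
Qed.

Lemma b_decrease : b * act / 4 <= b - b'.
Proof.
have [qh q1] := q_bounds; rewrite /step_b.
have -> : b - b * (1 - act * q + 12 * act ^+ 2) = b * act * (q - 12 * act) by ring.
rewrite -[leLHS]mulrA -[leRHS]mulrA ler_wpM2l ?(ltW b0) // ler_wpM2l ?(ltW act_gt0) //.
have := act_le; have := l_le; lra.
Qed.

Lemma b_lower : b / 2 <= b'.
Proof.
have [qh q1] := q_bounds; rewrite /step_b ler_wpM2l ?(ltW b0) //.
have : act * q <= act by rewrite ler_piMr // ltW.
have : 0 <= act ^+ 2 by rewrite sqr_ge0.
have := act_le; have := l_le; lra.
Qed.

Lemma invariant_step : invariant N' b' x'.
Proof.
have [qh q1] := q_bounds.
have bd := b_decrease; have bl := b_lower; have a0 := act_gt0; have b_0 := b0.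
have al := act_le; have ll := l_le.
have q0 : 0 < q by lra.
have ba0 : 0 < b * act by rewrite mulr_gt0.
case: inv => /andP[_ b1] _ yb NN NN0.
have N_0 : 0 < N.
  by apply: lt_le_trans NN; rewrite mulr_gt0 ?expR_gt0 // (lt_le_trans ltr01).
have a2 : act ^+ 2 <= 8^-1.
  rewrite expr2; apply: (@le_trans _ _ (act * 1)); last lra.
  by rewrite ler_wpM2l //; lra.
split.
- by apply/andP; split; lra.
- by rewrite /step_x !addr_ge0 // !mulr_ge0 // ?exprn_ge0 // ltW.
- have -> : x' + b' = x + b + 13 * (act * (b * act)).
    by rewrite /step_x /step_b; ring.
  have : act * (b * act / 4) <= act * (b - b') by rewrite ler_wpM2l // ltW.
  lra.
- have e4 : expR (- (4 * act ^+ 2)) <= 1 - 2 * act ^+ 2.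
    apply: le_trans (expRN_le _) _; first by rewrite mulr_ge0 // sqr_ge0.
    have : (act ^+ 2) * act ^+ 2 <= act ^+ 2 * 8^-1 by rewrite ler_wpM2l // sqr_ge0.
    lra.
  have qT : expR (- T) <= q.
    by rewrite expRN -div1r ler_pdivrMr ?expR_gt0 // q_expR.
  have step1 : N * expR (- T) * expR (- (4 * act ^+ 2)) <= N'.
    rewrite /step_N [leRHS]mulrC [q * N]mulrC; apply: ler_pM => //.
    + by rewrite mulr_ge0 ?expR_ge0 // ltW.
    + by rewrite ler_wpM2l // ltW.
  rewrite -[leLHS]mulrA -expRD in step1; apply: le_trans step1.
  apply: (@le_trans _ _ (N0 * expR (- ((1 + eta) * (D * x ^+ m)) - 16 * act * La ^+ 2 * (1 - b))
     * expR (- T + - (4 * act ^+ 2)))); last by rewrite ler_wpM2r ?expR_ge0.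
  rewrite -[leRHS]mulrA -expRD ler_wpM2l ?(le_trans ler01) // ler_expR.
  have Lb : 1 <= La ^+ 2 * b.
    apply: (@le_trans _ _ (La ^+ 2 * l ^+ 2)); first by rewrite -exprMn Lal expr1n.
    by rewrite ler_wpM2l // exprn_ge0 // ltW.
  have : act * La ^+ 2 * (b * act / 4) <= act * La ^+ 2 * (b - b').
    by rewrite ler_wpM2l // mulr_ge0 ?exprn_ge0 // ltW.
  have : act ^+ 2 * 1 <= act ^+ 2 * (La ^+ 2 * b) by rewrite ler_wpM2l // sqr_ge0.
  rewrite /T; lra.
- apply: le_trans NN0; rewrite /step_N mulrA ler_piMl ?(ltW N_0) //.
  rewrite mulr_ile1 //; [| | |exact: ltW]; first lra; first exact: ltW.
  by rewrite lerBlDr lerDl mulr_ge0 // sqr_ge0.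
Qed.

Let Lp n : 0 < La ^+ n. Proof. by rewrite exprn_gt0. Qed.

Lemma La_exp_le n p : (n <= p)%N -> La ^+ n <= La ^+ p.
Proof. by move=> np; rewrite ler_weXn2l //; apply: le_trans La_ge; lra. Qed.

Lemma act_La n : La ^+ (n + 3) * act = La ^+ n.
Proof. by rewrite exprD -mulrA -exprMn Lal expr1n mulr1. Qed.

Lemma act4_La n : act ^+ 4 * La ^+ (n + 12) = La ^+ n.
Proof. by rewrite -[act ^+ 4]exprM exprD mulrCA -exprMn [La^-1 * La]mulrC -/l Lal expr1n mulr1. Qed.

Lemma N_lower n : (n <= 20 + 6 * m)%N -> La ^+ n <= N.
Proof. by move=> nm; apply: le_trans (invariant_N inv); apply: La_exp_le. Qed.

Lemma N_pos : 0 < N.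
Proof. exact: lt_le_trans (Lp 0) (N_lower (leq0n _)). Qed.

(** Chernoff needs a large mean for every [i]. Even from [x = 0], the new [x'] is at least
    [act * b * q >= La ^- 6], so its powers cost at most [La ^+ (6 * m)]. In [b' * N'],
    [b >= La ^- 2] and the constants cost [La ^+ 3] out of [La ^+ (20 + 6 * m)]. The remaining 17
    exceeds the 12 consumed by [act ^+ 4] with room for [W = La ^+ 2]. *)
Lemma profile_lower i : (0 < i <= m)%N -> La ^+ 17 <= profile m D (b' * N') x' i.
Proof.
move=> /andP[i0 im]; have La100 := La_ge; have [qh q1] := q_bounds; have bl := b_lower; have b_0 := b0.
have q0 : 0 < q by lra.
have N'_ge : N / 4 <= N'.
  rewrite /step_N mulrA [leRHS]mulrC ler_wpM2l ?(ltW N_pos) //.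
  have : act ^+ 2 <= 8^-1.
    rewrite expr2; apply: (@le_trans _ _ (act * 1)); last by have := act_le; have := l_le; lra.
    by rewrite ler_wpM2l ?(ltW act_gt0) //; have := act_le; have := l_le; lra.
  have : 0 <= act ^+ 2 by rewrite sqr_ge0.
  move: (act ^+ 2) => a; nra.
have A_ge : La ^+ (17 + 6 * m) <= b' * N'.
  apply: (@le_trans _ _ (l ^+ 2 / 2 * (N / 4))); last first.
    apply: ler_pM => //; rewrite ?divr_ge0 ?exprn_ge0 ?(ltW N_pos) ?(ltW l_gt0) ?(ltW La_gt0) //.
    by apply: le_trans bl; rewrite ler_wpM2r.
  apply: (@le_trans _ _ (l ^+ 2 / 2 * (La ^+ (20 + 6 * m) / 4))); last first.
    apply: ler_wpM2l; first by rewrite divr_ge0 // exprn_ge0 // ltW.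
    by apply: ler_wpM2r; [rewrite invr_ge0 | apply: N_lower].
  have -> : La ^+ (20 + 6 * m) = La ^+ 2 * (La * La ^+ (17 + 6 * m)).
    by rewrite -exprS -exprD.
  have -> : l ^+ 2 / 2 * (La ^+ 2 * (La * La ^+ (17 + 6 * m)) / 4) =
    (La * l) ^+ 2 * (La / 8) * La ^+ (17 + 6 * m) by field.
  rewrite Lal expr1n mul1r ler_peMl ?(ltW (Lp _)) //; lra.
have x_ge : l ^+ 6 <= x'.
  apply: (@le_trans _ _ (act * b * q)); last first.
    rewrite /step_x -addrA addrCA lerDl addr_ge0 // mulr_ge0 ?exprn_ge0 // ltW //.
  apply: (@le_trans _ _ (act * l ^+ 2 * 2^-1)).
    rewrite /act -/l -exprD exprSr ler_wpM2l ?exprn_ge0 ?(ltW l_gt0) //.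
    by have := l_le; lra.
  apply: ler_pM => //; first by rewrite mulr_ge0 ?exprn_ge0 // ltW.
  by rewrite ler_wpM2l // ltW.
have x1 : l ^+ (6 * m) <= x' ^+ (m - i).
  apply: (@le_trans _ _ ((l ^+ 6) ^+ (m - i))); last first.
    by rewrite lerXn2r ?nnegrE ?exprn_ge0 ?(le_trans _ x_ge) // ?exprn_ge0 // ltW.
  rewrite -exprM ler_wiXn2l ?(ltW l_gt0) //.
  by rewrite leq_mul2l /= leq_subr.
have A1 : 1 <= b' * N' by apply: le_trans A_ge; rewrite exprn_ege1 //; lra.
apply: (@le_trans _ _ (La ^+ (17 + 6 * m) * l ^+ (6 * m))).
  by rewrite exprD -mulrA -exprMn Lal expr1n mulr1.
rewrite /profile; apply: ler_pM => //; rewrite ?exprn_ge0 // ?(ltW La_gt0) ?(ltW l_gt0) //.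
apply: le_trans A_ge _; apply: (@le_trans _ _ ((b' * N') ^+ i)).
  by rewrite ler_eXnr.
rewrite ler_peMl ?exprn_ge0 ?(le_trans ler01) //.
rewrite -[leLHS]mulr1; apply: ler_pM => //.
by rewrite ler1n bin_gt0.
Qed.

(** All other factors together are at most [expR La] to the power [3 * 4 + 2 = 14], and [La ^+ 2]
    exceeds [14 * La] by more than 3. *)
Lemma lll_condition : (1 + (N + 1) * (m.+1%:R * (2 ^+ m * expR La))) ^+ 4 *
  ((2 + (N + 1) * m%:R) * expR (- La ^+ 2)) <= 4^-1.
Proof.
have La100 := La_ge; set d := expR La; have d_ge : 1 + La <= d by apply: expR_ge1Dx.
have c_ge := c0_ge.
have m1 : 1 <= m%:R :> R by rewrite ler1n.
have c1 : 10 * (m.+1%:R * 2 ^+ m) <= La.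
  have : m.+1%:R * 2 ^+ m <= m.+1%:R * c0.
    by rewrite ler_wpM2l // /c0 ler_peMl ?exprn_ge0.
  have : eta * La <= La by rewrite ler_piMl ?(ltW La_gt0) //; case/andP: eta01.
  have := c0_le; have := La_gt0; lra.
have c2 : 2 <= m.+1%:R * 2 ^+ m :> R.
  apply: (@le_trans _ _ (2 * 1)); first by rewrite mulr1.
  by apply: ler_pM => //; rewrite ?ler_nat ?ltnS // exprn_ege1 // ler1n.
have c3 : m%:R <= m.+1%:R * 2 ^+ m :> R.
  rewrite -[leLHS]mulr1; apply: ler_pM => //; first by rewrite ler_nat.
  by rewrite exprn_ege1 // ler1n.
move: c1 c2 c3; set K := m.+1%:R * 2 ^+ m => c1 c2 c3.
have N_d : N <= d.
  have NN0 : N <= N0 by case: inv.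
  apply: le_trans NN0 _; apply: le_trans DN0.
  apply: (@le_trans _ _ (N0 ^+ m)); first by rewrite ler_eXnr.
  by rewrite ler_peMl ?exprn_ge0 // (le_trans ler01).
have N_0 := N_pos.
have d0 : 0 < d := expR_gt0 La.
have h1 : 1 + (N + 1) * (m.+1%:R * (2 ^+ m * d)) <= d ^+ 3.
  rewrite (mulrA m.+1%:R) -/K.
  apply: (@le_trans _ _ (1 + (2 * d) * (K * d))).
    rewrite lerD2l ler_wpM2r // ?mulr_ge0 ?(ltW d0) //; lra.
  apply: (@le_trans _ _ (d ^+ 2 * (1 + 2 * K))).
    rewrite mulrDr mulr1 (_ : d ^+ 2 * (2 * K) = 2 * d * (K * d)); last by ring.
    by rewrite lerD2r exprn_ege1 //; lra.
  rewrite [leRHS]exprSr ler_wpM2l ?exprn_ge0 ?(ltW d0) //; lra.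
have h2 : 2 + (N + 1) * m%:R <= d ^+ 2.
  apply: (@le_trans _ _ (2 + (2 * d) * K)).
    rewrite lerD2l; apply: ler_pM => //; lra.
  rewrite expr2; apply: (@le_trans _ _ (d * (2 + 2 * K))).
    by rewrite mulrDr (_ : d * (2 * K) = 2 * d * K) ?lerD2r ?ler_peMl //; [lra | ring].
  by rewrite ler_wpM2l ?(ltW d0) //; lra.
apply: (@le_trans _ _ ((d ^+ 3) ^+ 4 * (d ^+ 2 * expR (- La ^+ 2)))).
  apply: ler_pM.
  - by rewrite exprn_ge0 // addr_ge0 // !mulr_ge0 // ?addr_ge0 // ?mulr_ge0 ?exprn_ge0 ?(ltW d0) // ltW.
  - by rewrite mulr_ge0 ?expR_ge0 // addr_ge0 // mulr_ge0 // addr_ge0 // ltW.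
  - rewrite lerXn2r ?nnegrE ?exprn_ge0 ?(ltW d0) //.
    by rewrite addr_ge0 // !mulr_ge0 // ?addr_ge0 // ?mulr_ge0 ?exprn_ge0 ?(ltW d0) // ltW.
  - by rewrite ler_wpM2r ?expR_ge0.
rewrite mulrA -exprM -exprD -expRM_natl -expRD.
apply: (@le_trans _ _ (expR (- (3%:R)))).
  rewrite ler_expR expr2; have : 100 * La <= La * La by rewrite ler_wpM2r // ltW.
  rewrite /=; lra.
rewrite expRN lef_pV2 ?posrE ?expR_gt0 //.
by apply: le_trans (expR_ge1Dx _); lra.
Qed.

Variables (V C : finType) (E : {set {set V}}) (L0 : V -> {set C}).
Hypothesis uE : uncrowded E.
Hypothesis unifE : uniform E m.+1.

Lemma reduced_step : reduced E L0 m N (profile m D (b * N) x) ->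
  reduced E L0 m N' (profile m D (b' * N') x').
Proof.
have [qh q1] := q_bounds; have N_0 := N_pos; have a0 := act_gt0.
have D0 : 0 < D by apply: lt_le_trans D_ge1.
have [y2 _] := invariant_le2 inv.
have LN n : (n <= 20)%N -> La ^+ n <= N.
  by move=> n20; apply: N_lower; apply: leq_trans n20 (leq_addr _ _).
have La100 := La_ge; have La1 : 1 <= La by lra.
have L4 : La ^+ 4 = La ^+ 2 * La ^+ 2 by rewrite -exprD.
apply: (@nibble_step R V C E m uE unifE m_gt0 D N b x act _ D0 b0 x0 _ qh (La ^+ 2)
  (2 ^+ m * expR La)).
- by rewrite a0; have := act_le; have := l_le; lra.
- apply: (@le_trans _ _ (La ^+ (1 + 3) * act)); first by rewrite act_La expr1; lra.
  by rewrite ler_wpM2r ?(ltW a0) // LN.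
- apply: (@le_trans _ _ (act ^+ 4 * (2^-1 * La ^+ (4 + 12)))).
    rewrite mulrCA act4_La L4 mulrA ler_peMl ?(ltW (Lp _)) //.
    have : La <= La ^+ 2 by rewrite ler_eXnr.
    lra.
  apply: ler_wpM2l; first by rewrite exprn_ge0 // ltW.
  apply: ler_pM => //; first by rewrite ltW ?Lp.
  exact: LN.
- apply: (@le_trans _ _ (La ^+ (4 + 3) * act / 10)).
    rewrite act_La L4 -mulrA ler_peMr ?(ltW (Lp _)) //.
    have : La <= La ^+ 2 by rewrite ler_eXnr.
    lra.
  by rewrite ler_wpM2r ?invr_ge0 // ler_wpM2r ?(ltW a0) // LN.
- move=> i im; apply: (@le_trans _ _ (act ^+ 4 * (La ^+ (4 + 12) / 2))).
    rewrite mulrA act4_La L4 -mulrA ler_peMr ?(ltW (Lp _)) //.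
    have : La <= La ^+ 2 by rewrite ler_eXnr.
    lra.
  apply: ler_wpM2l; first by rewrite exprn_ge0 // ltW.
  apply: ler_wpM2r; first by rewrite invr_ge0.
  by apply: le_trans (profile_lower im); apply: La_exp_le.
- have -> : \sum_(1 <= i < m.+1) profile m D (b * N) x i =
     \sum_(1 <= i < m.+1) profile m D (b * N) x i * 1 ^+ i.
    by apply: eq_bigr => i _; rewrite expr1n mulr1.
  rewrite sum_profile mulr1; have b_0 := b0; have x_0 := x0.
  have N1 : 1 <= N by exact: (LN 0).
  apply: (@le_trans _ _ (D * (N * 2) ^+ m)).
    rewrite ler_wpM2l ?(ltW D0) // lerBlDr.
    apply: (@le_trans _ _ ((N * 2) ^+ m)); last by rewrite lerDl exprn_ge0.
    rewrite lerXn2r ?nnegrE ?addr_ge0 ?mulr_ge0 ?(ltW N_0) ?(ltW b_0) //.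
    apply: (@le_trans _ _ (N * (x + b))); last by rewrite ler_wpM2l // ltW.
    by rewrite mulrDr [b * N]mulrC lerD2r ler_peMl.
  rewrite exprMn mulrA mulrC ler_wpM2l ?exprn_ge0 //; apply: le_trans DN0.
  have NN0 : N <= N0 by case: inv.
  by rewrite ler_wpM2l ?(ltW D0) // lerXn2r ?nnegrE ?(ltW N_0) // (le_trans ler01).
- exact: lll_condition.
Qed.

End OneStep.

Variables (V C : finType) (E : {set {set V}}) (L0 : V -> {set C}).
Hypothesis uE : uncrowded E.
Hypothesis unifE : uniform E m.+1.
Hypothesis start : reduced E L0 m N0 (profile m D N0 0).

Lemma reach : exists N b x, [/\ invariant N b x, b <= l ^+ 2 &
  reduced E L0 m N (profile m D (b * N) x)].
Proof.
(* The least possible decrease of [b] in a round as long as [b > l ^+ 2]; more than [s^-1] rounds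
   would make [b] negative. *)
set s := l ^+ 2 * act / 4.
have s0 : 0 < s by rewrite divr_gt0 // mulr_gt0 // exprn_gt0.
have main t : exists N b x, [/\ invariant N b x, b <= l ^+ 2 \/ b <= 1 - t%:R * s &
    reduced E L0 m N (profile m D (b * N) x)].
  elim: t => [|t [N [b [x [inv bt red]]]]].
    exists N0, 1, 0; split; last by rewrite mul1r.
      split=> //; rewrite ?ltr01 ?lexx ?subrr ?mulr0 ?addr0 ?add0r //.
      by rewrite expr0n eqn0Ngt m_gt0 /= !mulr0 subr0 oppr0 expR0 mulr1.
    by right; rewrite mul0r subr0.
  have [bl|lb] := leP b (l ^+ 2).
    by exists N, b, x; split=> //; left.
  have lb' := ltW lb.
  exists (step_N m D N b x act), (step_b m D b x act), (step_x m D b x act); split.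
  - exact: invariant_step inv lb'.
  - right; case: bt => [/(lt_le_trans lb)|bt]; first by rewrite ltxx.
    have := b_decrease inv; have : s <= b * act / 4.
      by rewrite /s !ler_wpM2r ?invr_ge0 ?(ltW act_gt0).
    rewrite -natr1; lra.
  - exact: (@reduced_step _ _ _ inv lb' V C E L0 uE unifE red).
have [N [b [x [inv bt red]]]] := main (Num.truncn s^-1).+1.
exists N, b, x; split=> //; case: bt => // bt.
have : 1 < (Num.truncn s^-1).+1%:R * s by rewrite -ltr_pdivrMr // div1r truncnS_gt.
by case: inv => /andP[b0 _] _ _ _ _; lra.
Qed.

Theorem nibble_colouring : exists Phi : V -> C,
  (forall v, Phi v \in L0 v) /\ (forall e c, e \in E -> exists2 u, u \in e & Phi u != c).
Proof.
have [N [b [x [inv bl red]]]] := reach.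
have [y2 _] := invariant_le2 inv.
have La100 := La_ge.
have N1 : 1 <= N by apply: le_trans (invariant_N inv); rewrite exprn_ege1 //; lra.
have N_0 : 0 < N by apply: lt_le_trans N1.
have [n [Nn _ nmin]] := natceil_exists (ltW N_0).
have [phi [L [h1 h2 h3 h4 h5]]] := reduced_trim nmin red.
case: (inv) => /andP[b0 b1] x0 _ _ _.
have D0 : 0 <= D by apply: le_trans D_ge1.
have prof0 i : 0 <= profile m D (b * N) x i by rewrite profile_ge0 // mulr_ge0 // ltW.
have n0 : (0 < n)%N by rewrite -(ltr_nat R) (lt_le_trans N_0).
(* The sum is at most [D * ((x + b) ^+ m - x ^+ m)], of order [La * b]; the stopping value
   [b <= La ^- 2] therefore leaves a factor [La^-1] to beat the constants. *)
have small : m.+1%:R * \sum_(1 <= i < m.+1) profile m D (b * N) x i * n%:R^-1 ^+ i <= 4^-1.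
  apply: (@le_trans _ _ (m.+1%:R * (D * ((x + b) ^+ m - x ^+ m)))).
    rewrite ler_wpM2l //.
    have -> : b = b * N * N^-1 by rewrite mulfK // gt_eqF.
    rewrite -sum_profile mulfVK ?gt_eqF //.
    apply: ler_sum => i _; rewrite ler_wpM2l // lerXn2r ?nnegrE ?invr_ge0 ?(ltW N_0) //.
    by rewrite lef_pV2 ?posrE // ltr0n.
  have hb : (x + b) ^+ m - x ^+ m <= l ^+ 2 * c0.
    have xb : 0 <= x <= x + b by rewrite x0 lerDl ltW.
    apply: le_trans (expr_sub_le m xb y2) _; rewrite [x + b]addrC addrK.
    by rewrite ler_wpM2r // (le_trans _ c0_ge).
  apply: (@le_trans _ _ (m.+1%:R * (La * (l ^+ 2 * c0)))).
    rewrite ler_wpM2l //; apply: ler_pM => //.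
    by rewrite subr_ge0 lerXn2r ?nnegrE ?addr_ge0 ?(ltW b0) // lerDl ltW.
  rewrite (_ : m.+1%:R * (La * (l ^+ 2 * c0)) = (La * l) * l * (m.+1%:R * c0)); last by ring.
  rewrite Lal mul1r; have h : m.+1%:R * c0 <= La / 60.
    have etaLa : eta * La <= La by rewrite ler_piMl ?(ltW La_gt0) //; case/andP: eta01.
    have := c0_le; lra.
  apply: (@le_trans _ _ (l * (La / 60))); first by rewrite ler_wpM2l // ltW.
  by rewrite mulrA [l * La]mulrC Lal mul1r; lra.
have [Phi [p1 p2 p3]] := finish_colouring unifE h3 h4 h5 prof0 n0 small.
exists Phi; split=> // v; case pv: (phi v) => [c|].
  by rewrite (p1 _ _ pv) h1.
by apply: (subsetP (h2 v)); apply: p2.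
Qed.

End Iteration.

(** * From lists of integers to the nibble *)

Section Asymptotics.
Variable R : realType.
Implicit Types (e K x : R).

Lemma ln_le_linear K c : 0 <= K -> 0 < c ->
  exists x0 : R, forall x, x0 <= x -> K * ln x + 1 <= c * x.
Proof.
(* In [ln x <= ln t + x / t] this choice gives the linear term a slope, after multiplication by [K],
   of at most [c / 2]. *)
move=> K0 c0; pose t := 2 * (K + 1) / c.
have t0 : 0 < t by rewrite divr_gt0 // mulr_gt0 // ltr_wpDl.
exists (Num.max 1 (2 * (K * ln t + 1) / c)) => x; rewrite ge_max => /andP[x1 xb].
have x0 : 0 < x by apply: lt_le_trans x1.
have h : ln x <= ln t + x / t.
  have -> : ln x = ln t + ln (x / t).
    by rewrite ln_div ?posrE //; ring.
  rewrite lerD2l.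
  by apply: ltW; apply: ln_sublinear; rewrite divr_gt0.
have h2 : K * (x / t) <= c * x / 2.
  have -> : c * x / 2 = (K + 1) * (x / t).
    by rewrite /t invf_div; field; rewrite lt0r_neq0 ?ltr_wpDl.
  apply: ler_wpM2r; last by rewrite lerDl.
  by rewrite divr_ge0 // ltW.
have h3 : K * ln t + 1 <= c * x / 2.
  by move: xb; rewrite ler_pdivrMr //; lra.
have : K * ln x <= K * (ln t + x / t) by rewrite ler_wpM2l.
lra.
Qed.

(** The iteration is run with [eta = e / 8]. In [21 + 6 * m], the exponent [20 + 6 * m] is that of
    [N0_big], and one more [ln La] pays for the logarithm of the density. *)
Definition large (m : nat) e (La : R) :=
  [/\ 100 <= La, m.+1%:R * (m%:R * 2 ^+ m) * 60 <= e / 8 * La &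
      (21 + 6 * m)%:R * ln La + 1 <= e / (4 * m%:R) * La].

Lemma eventually_large m e : (0 < m)%N -> 0 < e ->
  exists d0 : nat, forall d : R, d0%:R <= d -> 0 < d /\ large m e (ln d).
Proof.
move=> m0 e0; have m0' : 0 < m%:R :> R by rewrite ltr0n.
have c0 : 0 < e / (4 * m%:R) by rewrite divr_gt0 // mulr_gt0.
have [x0 hx0] := ln_le_linear (ler0n R (21 + 6 * m)) c0.
pose M := Num.max 100 (Num.max (m.+1%:R * (m%:R * 2 ^+ m) * 60 / (e / 8)) x0).
exists (Num.truncn (expR M)).+1 => d dM.
have d1 : expR M <= d by apply: le_trans dM; apply: ltW; apply: truncnS_gt.
have d0 : 0 < d by apply: lt_le_trans d1; apply: expR_gt0.
have : M <= ln d by rewrite -[M]expRK ler_ln ?posrE ?expR_gt0.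
rewrite /M !ge_max => /and3P[h1 h2 h3]; split=> //; split=> //.
  by move: h2; rewrite ler_pdivrMr ?divr_gt0 // [e / 8 * _]mulrC.
exact: hx0.
Qed.

End Asymptotics.

(** * Initial list size and density *)

Section Constants.
Variables (R : realType) (m : nat) (e d : R).
Hypothesis m_gt0 : (0 < m)%N.
Hypothesis e01 : 0 < e <= 1.
Hypothesis d_gt0 : 0 < d.
Hypothesis d_large : large m e (ln d).

Let La := ln d.
Let e0 : 0 < e. Proof. by case/andP: e01. Qed.
Let e1 : e <= 1. Proof. by case/andP: e01. Qed.
Let La100 : 100 <= La. Proof. by case: d_large. Qed.
Let La_gt0 : 0 < La. Proof. by apply: lt_le_trans La100; rewrite ltr0n. Qed.
Let m_gt0' : 0 < m%:R :> R. Proof. by rewrite ltr0n. Qed.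

Definition list_size : R := (1 + e) * (m%:R * (d / ln d)) `^ (1 / m%:R).
Definition density : R := ln d / (m%:R * (1 + e) ^+ m).

Let P_gt0 : 0 < m%:R * (1 + e) ^+ m.
Proof. by rewrite mulr_gt0 // exprn_gt0 // addr_gt0. Qed.

Let D_gt0 : 0 < density. Proof. by rewrite divr_gt0. Qed.

Lemma list_size_gt0 : 0 < list_size.
Proof.
by rewrite mulr_gt0 ?addr_gt0 // powR_gt0 // mulr_gt0 // divr_gt0.
Qed.

Lemma density_list_size : density * list_size ^+ m = d.
Proof.
have m_d : 0 <= m%:R * (d / ln d) by rewrite mulr_ge0 // divr_ge0 // ltW.
have root : ((m%:R * (d / ln d)) `^ (1 / m%:R)) ^+ m = m%:R * (d / ln d).
  by rewrite -[LHS]powR_mulrn ?powR_ge0 // -powRrM div1r mulVf ?gt_eqF // powRr1.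
rewrite exprMn root /density -/La.
have h := lt0r_neq0 La_gt0; have h1 := lt0r_neq0 m_gt0'.
have h2 : (1 + e) ^+ m != 0 by rewrite gt_eqF // exprn_gt0 // addr_gt0.
by field; rewrite h h1 h2.
Qed.

Lemma density_bounds : 1 <= density /\ density * (1 + e) <= La / m%:R.
Proof.
split.
  rewrite ler_pdivlMr // mul1r; case: d_large => _ h _.
  have h1 : (1 + e) ^+ m <= 2 ^+ m.
    by rewrite lerXn2r ?nnegrE ?addr_ge0 ?(ltW e0) // [leRHS]mulrSr lerD2l.
  have h2 : m%:R * (1 + e) ^+ m <= m%:R * 2 ^+ m by rewrite ler_wpM2l.
  have h3 : e / 8 * La <= La by rewrite ler_piMl ?(ltW La_gt0) //; have := e1; lra.
  have h4 : m%:R * 2 ^+ m <= m.+1%:R * (m%:R * 2 ^+ m) :> R.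
    by rewrite ler_peMl ?mulr_ge0 ?exprn_ge0 // ler1n.
  have : 0 <= m%:R * 2 ^+ m :> R by rewrite mulr_ge0 ?exprn_ge0.
  by rewrite -/La in h *; lra.
rewrite /density -/La invfM mulrA -mulrA ler_piMr ?divr_ge0 ?(ltW La_gt0) //.
rewrite mulrC ler_pdivrMr ?exprn_gt0 ?addr_gt0 // mul1r ler_eXnr // lerDl ltW //.
Qed.

Lemma density_le : density <= La.
Proof.
have [D1 D2] := density_bounds; apply: (@le_trans _ _ (density * (1 + e))).
  by rewrite ler_peMr ?(ltW D_gt0) // lerDl ltW.
by apply: le_trans D2 _; rewrite ler_pdivrMr // ler_peMr ?(ltW La_gt0) // ler1n.
Qed.

Lemma list_size_lower : expR ((La - ln density) / m%:R) <= list_size.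
Proof.
rewrite -(@ler_pXn2r _ m) ?nnegrE ?expR_ge0 ?(ltW list_size_gt0) //.
rewrite -expRM_natl mulrC divfK ?gt_eqF // expRB !lnK ?posrE //.
by rewrite ler_pdivrMr // mulrC density_list_size.
Qed.

(** Since [(1 + e / 8) ^+ 2 <= (1 - e / 4) * (1 + e)], the loss in the exponent is at most
    [(1 - e / 4) * (La / m)], while the lists start near [expR (La / m)]. The surplus
    [e / (4 * m) * La] outgrows any multiple of [ln La]. *)
Lemma list_size_big :
  La ^+ (20 + 6 * m) <= list_size * expR (- ((1 + e / 8) ^+ 2 * density) - 1).
Proof.
have [D1 D2] := density_bounds; have := list_size_lower; rewrite -(ler_pM2r (expR_gt0 (- ((1 + e / 8) ^+ 2 * density) - 1))).
apply: le_trans; rewrite -expRD.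
rewrite -[X in X ^+ _]lnK ?posrE // -expRM_natl ler_expR.
have Dlt : ln density <= ln La by rewrite ler_ln ?posrE // density_le.
have La1 : 0 <= ln La by apply: ln_ge0; apply: le_trans La100; rewrite ler1n.
have h1 : (1 + e / 8) ^+ 2 * density <= (1 - e / 4) * (La / m%:R).
  apply: (@le_trans _ _ ((1 - e / 4) * (density * (1 + e)))); last first.
    by apply: ler_wpM2l D2; have := e1; lra.
  have -> : (1 - e / 4) * (density * (1 + e)) = (1 - e / 4) * (1 + e) * density by ring.
  apply: ler_wpM2r; first exact: ltW.
  have := e0; have := e1 => a1 a0; nra.
have h2 : (La - ln La) / m%:R <= (La - ln density) / m%:R.
  by rewrite ler_wpM2r ?invr_ge0 // lerB.
have h3 : ln La / m%:R <= ln La.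
  by rewrite ler_pdivrMr // ler_peMr // ler1n.
case: d_large => _ _; rewrite -/La => h4.
have h5 : e / (4 * m%:R) * La = e / 4 * (La / m%:R) by rewrite invfM; ring.
have hK : (21 + 6 * m)%:R = (20 + 6 * m)%:R + 1 :> R by rewrite natr1.
move: h4; rewrite h5 hK mulrDl mul1r => h4.
have h6 : (La - ln La) / m%:R = La / m%:R - ln La / m%:R by rewrite mulrBl.
rewrite h6 in h2; lra.
Qed.

Lemma list_size_ge1 : 1 <= list_size.
Proof.
apply: (@le_trans _ _ (La ^+ (20 + 6 * m))).
  by rewrite exprn_ege1 //; apply: le_trans La100; rewrite ler1n.
apply: le_trans list_size_big _; rewrite ler_piMr ?(ltW list_size_gt0) //.
rewrite -expR0 ler_expR -opprD oppr_le0 addr_ge0 // mulr_ge0 ?sqr_ge0 // ltW //.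
Qed.

End Constants.

Local Open Scope classical_set_scope.
Local Open Scope ring_scope.

(** * Passage to finitely many colours *)

Lemma counting_seq (R : realType) (A : set nat) (r : R) : (r%:E <= counting A)%E ->
  exists s : seq nat, [/\ uniq s, forall c, c \in s -> A c & r <= (size s)%:R].
Proof.
rewrite /counting; case: asboolP => [fA|iA] rA.
  exists (finmap.enum_fset (fset_set A)); split; first exact: finmap.fset_uniq.
    by move=> c; rewrite in_fset_set // => /set_mem.
  by rewrite lee_fin in rA; exact: rA.
have [B BA nB] := infinite_set_fset (Num.truncn r).+1 iA.
exists (finmap.enum_fset B); split; first exact: finmap.fset_uniq.
  by move=> c cB; apply: BA.
by apply: le_trans (ltW (truncnS_gt r)) _; rewrite ler_nat.
Qed.

(** With nothing coloured, every edge has exactly [m] other open vertices, so only [i = m] occurs;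
    there the profile at [x = 0] equals [D * N ^+ m = d], which is (C2). *)
Lemma initial_reduced (R : realType) (V : finType) (E : {set {set V}}) (m M : nat)
    (L : V -> set nat) (s : V -> seq nat) (d N D : R) :
  (0 < m)%N -> 0 <= D -> 0 <= N -> D * N ^+ m = d ->
  uniform E m.+1 -> (forall v, uniq (s v)) -> (forall v c, c \in s v -> L v c) ->
  (forall v, N <= (size (s v))%:R) -> (forall v c, c \in s v -> (c <= M)%N) ->
  (forall v c, L v c -> (color_degree E L v c)%:R <= d) ->
  reduced E (fun v => [set c : 'I_M.+1 | val c \in s v]%SET) m N (profile m D N 0).
Proof.
move=> m0 D0 N0 DN unifE us sL Ns sM Ld.
exists (fun=> None), (fun v => [set c : 'I_M.+1 | val c \in s v]%SET); split=> //.
- move=> e c eE _; rewrite (_ : [set u in e | _]%SET = e) ?unifE //.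
  by apply/setP => u; rewrite !inE andbT.
- move=> v _; apply: le_trans (Ns v) _; rewrite ler_nat.
  rewrite -(size_map (fun c => inord c : 'I_M.+1)).
  have /card_uniqP <- : uniq [seq inord c : 'I_M.+1 | c <- s v].
    rewrite map_inj_in_uniq // => c c' /sM cM /sM c'M /(congr1 val).
    by rewrite /= !inordK.
  apply: subset_leq_card; apply/subsetP => c /mapP[c' c's ->].
  by rewrite inE /= inordK // ltnS; apply: sM c's.
- move=> v c _ cs i /andP[i0 im].
  have cardo e : e \in E -> v \in e -> #|others (fun=> None : option 'I_M.+1) e v| = m.
    move=> eE ve; apply: succn_inj; rewrite -(unifE e eE) (cardsD1 v e) ve add1n; congr _.+1.
    by apply: eq_card => u; rewrite !inE andbC.
  have [->|imN] := eqVneq i m.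
    rewrite /profile binn mulr1 subnn expr0 mulr1 DN.
    apply: le_trans (Ld v (val c) _); last by apply: sL; rewrite inE in cs.
    rewrite ler_nat; apply: subset_leq_card; apply/subsetP => e.
    rewrite !inE => /andP[/and3P[eE ve le] _]; rewrite eE ve /=.
    apply/mem_set => u /= ue; apply: sL; have := forall_inP le u ue.
    by rewrite /= inE.
  rewrite (_ : deg _ _ _ _ _ _ = 0%N) ?profile_ge0 //.
  apply/eqP; rewrite cards_eq0; apply/eqP/setP => e; rewrite !inE.
  apply/negP => /andP[/and3P[eE ve _]]; rewrite cardo // => /eqP mi.
  by rewrite mi eqxx in imN.
Qed.

(* counting (L v) is the cardinality of L v in \bar R, +oo if L v is infinite. *)
Theorem theorem1p8 (R : realType) (k : nat) (eps : R) :
  (2 <= k)%N -> 0 < eps ->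
  exists d0 : nat, forall d : R, d0%:R <= d ->
  forall (V : finType) (E : {set {set V}}) (L : V -> set nat),
    uniform E k -> uncrowded E ->
    (forall v : V,
      (((1 + eps) *
        ((k - 1)%:R * (d / ln d)) `^ (1 / (k - 1)%:R))%:E <= counting (L v))%E) ->
    (forall (v : V) (c : nat), L v c -> (color_degree E L v c)%:R <= d) ->
    exists Phi : V -> nat, list_coloring E L Phi.
Proof.
case: k => [//|m]; rewrite ltnS => m0 eps0; rewrite subn1 /=.
(* Lowering [eps] only weakens (C1), and [e <= 1] enters the numerical estimates, for instance
   [(1 + e) ^+ m <= 2 ^+ m]. *)
pose e := Num.min eps 1.
have e01 : 0 < e <= 1 by rewrite lt_min eps0 ltr01 ge_min lexx orbT.
have [d0 hd0] := eventually_large m0 (proj1 (andP e01)).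
exists d0 => d /hd0[d_gt0 dl] V E L unifE uE sizeL degL.
have [D1 D2] := density_bounds m0 e01 dl.
have N1 := list_size_ge1 m0 e01 d_gt0 dl.
have /choice[s sP] : forall v, exists s : seq nat,
    [/\ uniq s, forall c, c \in s -> L v c & list_size m e d <= (size s)%:R].
  move=> v; apply: counting_seq; apply: le_trans (sizeL v); rewrite lee_fin.
  by rewrite ler_wpM2r ?powR_ge0 // lerD2l ge_min lexx.
(* The chosen finite lists lie in ['I_M.+1], which serves as the finite type of colours. *)
pose M := \max_v \max_(c <- s v) c.
have sM v c : c \in s v -> (c <= M)%N.
  move=> cs; apply: leq_trans (leq_bigmax v); exact: leq_bigmax_seq.
have start := initial_reduced m0 (le_trans ler01 D1) (le_trans ler01 N1)
  (density_list_size m0 e01 d_gt0 dl) unifE (fun v => let: And3 h _ _ := sP v in h)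
  (fun v => let: And3 _ h _ := sP v in h) (fun v => let: And3 _ _ h := sP v in h) sM degL.
case: (dl) => La100 Lab _.
have [Phi [PhiL Phip]] : exists Phi : V -> 'I_M.+1,
    (forall v, Phi v \in [set c : 'I_M.+1 | val c \in s v]%SET) /\
    (forall e c, e \in E -> exists2 u, u \in e & Phi u != c).
  apply: (nibble_colouring m0 La100 D1 _ _ Lab _ N1
    (list_size_big m0 e01 d_gt0 dl) uE unifE start).
  - exact: (density_le m0 e01 dl).
  - by case/andP: e01 => e0 e1; apply/andP; split; lra.
  - by rewrite (density_list_size m0 e01 d_gt0 dl) lnK.
exists (fun v => val (Phi v)); split.
  by move=> v; case: (sP v) => _ h _; apply: h; have := PhiL v; rewrite inE.
move=> f fE [c hc]; have [u0 u0f _] := Phip f ord0 fE.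
have [u uf /eqP[]] := Phip f (Phi u0) fE.
by apply: val_inj; rewrite /= !hc.
Qed.
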